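(* Let $G$ be a graph of Class $2$, i.e. $\chi'(G)=\Delta(G)+1$, and let $t_\Delta$ be the number of vertices of $G$ of degree $\Delta(G)$. Then $$\mathrm{es}_{\chi'}(G)\leq \frac{t_\Delta-1}{2}.$$ Furthermore, if $G$ is connected and $t_\Delta$ is odd, then equality $\mathrm{es}_{\chi'}(G)=\frac{t_\Delta-1}{2}$ holds if and only if there are integers $n$ and $s$ with $0\leq s\leq n-1$ such that $G$ is (isomorphic to a graph) obtained from the complete graph $K_{2n+1}$ by removing $s$ independent (pairwise non-incident) edges.
   Context: All graphs are finite, simple (no loops or multiple edges) and have at least one edge. $\Delta(G)$ denotes the maximum degree of $G$. The chromatic index $\chi'(G)$ is the minimum number of colors in a proper edge coloring of $G$ (incident edges receive different colors); an edgeless graph, which may arise after deleting edges, has chromatic index $0$. $G$ is Class $1$ if $\chi'(G)=\Delta(G)$ and Class $2$ if $\chi'(G)=\Delta(G)+1$. The chromatic edge stability index $\mathrm{es}_{\chi'}(G)$ is the minimum number of edges of $G$ whose removal (keeping all vertices) results in a graph $H$ with $\chi'(H)=\chi'(G)-1$; equivalently, the minimum size of a set $F\subseteq E(G)$ with $\chi'(G\setminus F)<\chi'(G)$. *)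

(* Defs.v *)
From mathcomp Require Import all_boot.

Set Implicit Arguments.
Unset Strict Implicit.
Unset Printing Implicit Defensive.

Record sgraph := SGraph {
  vertex :> finType;
  adj : rel vertex;
  adj_sym : symmetric adj;
  adj_irrefl : irreflexive adj
}.

Section Graph.
Variable G : sgraph.

Definition edges : {set {set G}} :=
  [set [set p.1; p.2] | p : G * G & adj p.1 p.2].

Definition degree (x : G) : nat := #|[set y | adj x y]|.

Definition max_degree : nat := \max_(x : G) degree x.

Definition num_max_degree : nat := #|[set x : G | degree x == max_degree]|.

Definition connected_graph : Prop := forall x y : G, connect (@adj G) x y.

Definition edge : finType := {e : {set G} | e \in edges}.

(* The colouring is defined on the type of edges only, so that an edgeless
   graph is colourable with [k = 0] colours. *)
Definition proper_edge_coloring (k : nat) (c : {ffun edge -> 'I_k}) : bool :=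
  [forall e : edge, forall f : edge,
    (e != f) && ~~ [disjoint val e & val f] ==> (c e != c f)].

Definition edge_colorable (k : nat) : bool :=
  [exists c : {ffun edge -> 'I_k}, proper_edge_coloring c].

Lemma edge_colorable_exists : exists k, edge_colorable k.
Proof.
exists #|edge|; apply/existsP; exists [ffun e => enum_rank e].
apply/forallP=> e; apply/forallP=> f; apply/implyP=> /andP[nef _].
by rewrite !ffunE (inj_eq enum_rank_inj).
Qed.

Definition chromatic_index : nat := ex_minn edge_colorable_exists.

Definition class2 : Prop := chromatic_index = max_degree.+1.

Section Delete.
Variable F : {set {set G}}.

Definition del_adj : rel G := fun x y => adj x y && ([set x; y] \notin F).

Lemma del_adj_sym : symmetric del_adj.
Proof. by move=> x y; rewrite /del_adj adj_sym setUC. Qed.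

Lemma del_adj_irrefl : irreflexive del_adj.
Proof. by move=> x; rewrite /del_adj adj_irrefl. Qed.

End Delete.
End Graph.

Definition del_edges (G : sgraph) (F : {set {set G}}) : sgraph :=
  SGraph (@del_adj_sym G F) (@del_adj_irrefl G F).

Lemma edges_del (G : sgraph) (F : {set {set G}}) :
  edges (del_edges F) = edges G :\: F.
Proof.
apply/setP=> e; rewrite in_setD; apply/imsetP/andP.
  case=> -[x y]; rewrite inE /= => /andP[axy nF] ->; split=> //.
  by apply/imsetP; exists (x, y); rewrite ?inE.
case=> nF /imsetP[[x y]]; rewrite inE /= => axy eE.
by exists (x, y); rewrite // inE /= /del_adj axy -eE.
Qed.

Lemma edge_colorableP (G : sgraph) (k : nat) :
  edge_colorable G k <->
  exists c : {set G} -> nat, (forall e, e \in edges G -> c e < k) /\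
    (forall e f, e \in edges G -> f \in edges G ->
      e != f -> ~~ [disjoint e & f] -> c e != c f).
Proof.
split.
  case/existsP=> c /forallP pc.
  exists (fun e => if insub e is Some u then val (c (u : edge G)) else 0).
  split=> [e eE | e f eE fE nef dis].
    by rewrite (insubT (fun e => e \in edges G) eE) ltn_ord.
  rewrite (insubT (fun e => e \in edges G) eE).
  rewrite (insubT (fun e => e \in edges G) fE).
  have /forallP/(_ (Sub f fE))/implyP := pc (Sub e eE).
  by rewrite -val_eqE /= nef dis; apply.
case=> c [ck pc]; apply/existsP.
exists [ffun e : edge G => Ordinal (ck _ (valP e))].
apply/forallP=> e; apply/forallP=> f; apply/implyP=> /andP[nef dis].
by rewrite !ffunE -val_eqE /=; apply: pc (valP e) (valP f) _ dis.
Qed.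

Lemma es_exists (G : sgraph) : exists n, [exists F : {set {set G}},
  [&& F \subset edges G, chromatic_index (del_edges F) == (chromatic_index G).-1
    & #|F| == n]].
Proof.
suff [F [FE chiF]] : exists F : {set {set G}}, F \subset edges G /\
    chromatic_index (del_edges F) = (chromatic_index G).-1.
  by exists #|F|; apply/existsP; exists F; rewrite FE chiF !eqxx.
rewrite [chromatic_index G]/chromatic_index.
case: ex_minnP => -[|k] /edge_colorableP[c [ck pc]] kmin /=.
  exists set0; split; first exact: sub0set.
  rewrite /chromatic_index; case: ex_minnP => m _ mmin; apply/eqP.
  rewrite -leqn0 mmin //; apply/edge_colorableP; exists c.
  by rewrite edges_del setD0.
exists [set e in edges G | c e == k]; split.
  by apply/subsetP=> e; rewrite inE => /andP[].
set F := [set e in _ | _]; rewrite /chromatic_index; case: ex_minnP => m.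
move=> /edge_colorableP[d [dm pd]] mmin; apply/eqP; rewrite eqn_leq.
apply/andP; split.
  apply: mmin; apply/edge_colorableP; exists c; rewrite edges_del; split.
    move=> e; rewrite !inE => /andP[+ eE]; rewrite eE /= => nk.
    by have := ck e eE; rewrite ltnS leq_eqVlt (negPf nk).
  by move=> e f /setDP[eE _] /setDP[fE _]; apply: pc.
rewrite -ltnS; apply: kmin; apply/edge_colorableP.
exists (fun e => if e \in F then m else d e); split=> [e eE|e f eE fE nef dis].
  case: ifPn => // nF; rewrite ltnS ltnW // dm // edges_del.
  by apply/setDP.
have dF g : g \in edges G -> g \notin F -> d g < m.
  by move=> gE gF; apply: dm; rewrite edges_del; apply/setDP.
case: ifPn => eF; case: ifPn => fF.
- move: eF fF; rewrite !inE => /andP[_ /eqP ce] /andP[_ /eqP cf].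
  by have := pc e f eE fE nef dis; rewrite ce cf eqxx.
- by rewrite gtn_eqF // dF.
- by rewrite ltn_eqF // dF.
- by apply: pd nef dis; rewrite edges_del; apply/setDP.
Qed.

(* Since [0.-1 = 0], this takes the conventional value 0 on edgeless graphs. *)
Definition chromatic_edge_stability (G : sgraph) : nat := ex_minn (es_exists G).

Definition isomorphic (G H : sgraph) : Prop :=
  exists f : G -> H, bijective f /\ forall x y, adj (f x) (f y) = adj x y.

Section Complete.
Variable m : nat.

Definition complete_adj : rel 'I_m := fun i j => i != j.

Lemma complete_adj_sym : symmetric complete_adj.
Proof. by move=> i j; rewrite /complete_adj eq_sym. Qed.

Lemma complete_adj_irrefl : irreflexive complete_adj.
Proof. by move=> i; rewrite /complete_adj eqxx. Qed.

Definition complete_graph : sgraph :=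
  SGraph complete_adj_sym complete_adj_irrefl.

End Complete.

Definition complete_minus_matching (n s : nat) (G : sgraph) : Prop :=
  exists F : {set {set complete_graph (2 * n + 1)}},
    [/\ F \subset edges (complete_graph (2 * n + 1)), trivIset F, #|F| = s
      & isomorphic G (del_edges F)].

(* Main.v *)
Require Import Defs.
From mathcomp Require Import all_boot all_order all_algebra.
From mathcomp Require Import zify.
Set Implicit Arguments.
Unset Strict Implicit.
Unset Printing Implicit Defensive.

(** Let k be the maximum degree of the Class 2 graph G and let the core be the
    set of its t vertices of degree k.

    The engine is Vizing's adjacency lemma [vizing_adjacency]: if G has maximum
    degree at most k and is not k-edge-colourable, but becomes so when the edge
    xy is removed, then x has more than k - deg y neighbours of degree k besides
    y.  Applied to an edge-minimal non-colourable subgraph it shows that the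
    vertices of degree k in that subgraph induce a graph of minimum degree at
    least two ([noncolorable_core]); in particular a non-colourable graph has at
    least three vertices of degree k, and they are not independent.

    Upper bound ([stability_bound]).  Remove a maximum matching of the core.  The
    vertices that keep degree k are independent, so k colours suffice for the
    rest.  If the matching covers the whole core, one of its edges can be kept:
    only two vertices of degree k remain.  Either way 2 es + 1 <= t.

    Equality ([stability_extremal]).  If 2 es + 1 = t, a maximum matching M of
    the core leaves exactly one vertex w, and for every edge ab of M the graph
    H = G - (M - ab) is still not k-edge-colourable, while a, b, w are its only
    vertices of degree k.  By [three_core_component] they form a triangle, and
    they lie in a component of H in which all other vertices have degree k - 1
    and at least two neighbours in the triangle; connectedness of G makes this
    component spanning.  It remains to see that H has k + 1 vertices
    ([three_core_order], a theorem of Chetwynd and Hilton).  Otherwise some y is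
    not adjacent to, say, w.  If a matching containing vw covers everything but y
    then deleting it leaves a graph of maximum degree k - 1 in which w has a
    single neighbour of maximum degree; [noncolorable_core] then forces it to be
    (k - 1)-edge-colourable, a contradiction.  Such a matching exists by an
    Ore-type augmentation argument ([ore_matching]), because every outer vertex
    sees two vertices of the triangle and thus the order is at most 3k/2; the
    only numerical exception, k = 6 on nine vertices, is excluded by using the
    edge uw as well.  Hence every vertex of G has at most one non-neighbour, so
    the complement of G is a matching, and t >= 3 bounds its size.

    Conversely ([near_complete_stability]), K_(2n+1) minus s < n independent edges
    is overfull: a class of a proper colouring misses a vertex because the order
    is odd, so 2n colours cover at most 2n * n edges, and n - s = (t - 1) / 2
    edges have to be removed. *)

(** * Edge colourings as symmetric functions on arcs *)

(** Symmetry is required on arcs only, so that a Kempe swap may be defined from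
    its first argument alone. *)
Definition arc_coloring (T : finType) (r : rel T) (k : nat) (c : T -> T -> nat) :=
  [/\ forall x y, r x y -> c x y < k,
      forall x y, r x y -> c x y = c y x
    & forall x y z, r x y -> r x z -> c x y = c x z -> y = z].

Lemma edge_pair (G : sgraph) (x y : G) : ([set x; y] \in edges G) = adj x y.
Proof.
apply/imsetP/idP => [[[a b]] | axy]; last by exists (x, y); rewrite ?inE.
rewrite inE /= => ab E.
have nab : a != b by apply/eqP=> Eab; rewrite Eab adj_irrefl in ab.
have := set21 a b; have := set22 a b; rewrite -E !inE.
case/orP=> /eqP Eb; case/orP=> /eqP Ea; subst; rewrite ?eqxx // in nab *.
by rewrite adj_sym.
Qed.

Lemma edgeP (G : sgraph) (e : {set G}) (x : G) :
  e \in edges G -> x \in e -> exists2 y, adj x y & e = [set x; y].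
Proof.
case/imsetP=> -[a b]; rewrite inE /= => ab ->; rewrite !inE.
case/orP=> /eqP->; first by exists b.
by exists a; [rewrite adj_sym | rewrite setUC].
Qed.

Lemma set2_inj (T : finType) (x y z : T) : [set x; y] = [set x; z] -> y = z.
Proof.
move=> E; have: y \in [set x; z] by rewrite -E set22.
have: z \in [set x; y] by rewrite E set22.
by rewrite !inE => /orP[] /eqP E1 /orP[] /eqP E2; congruence.
Qed.

Lemma edge_colorable_arcP (G : sgraph) k :
  edge_colorable G k <-> exists c, arc_coloring (@adj G) k c.
Proof.
rewrite edge_colorableP; split=> [[c [ck cP]] | [c [ck cs cP]]].
  exists (fun x y => c [set x; y]); split=> [x y axy|x y _|x y z axy axz E].
  - by apply: ck; rewrite edge_pair.
  - by rewrite setUC.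
  apply/eqP; apply: contraTT isT => nyz.
  have /negP[] : c [set x; y] != c [set x; z]; last exact/eqP.
  apply: cP; rewrite ?edge_pair //.
    by apply: contraNneq nyz => /set2_inj->.
  by apply/pred0Pn; exists x; rewrite /= !inE eqxx.
pose d (e : {set G}) :=
  if [pick p | adj p.1 p.2 && (e == [set p.1; p.2])] is Some p
  then c p.1 p.2 else 0.
have dE x y : adj x y -> d [set x; y] = c x y.
  move=> axy; rewrite /d; case: pickP => [[a b] /= /andP[ab /eqP E]|].
    have: a \in [set x; y] by rewrite E set21.
    rewrite !inE => /orP[] /eqP Ea; subst a.
      by rewrite (set2_inj E).
    by move: E; rewrite setUC => /set2_inj E; subst b; rewrite cs.
  by move/(_ (x, y)); rewrite /= axy eqxx.
exists d; split=> [e eE|e f eE fE nef].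
  case/imsetP: (eE) => -[a b]; rewrite inE /= => ab ->.
  by rewrite dE // ck.
case/pred0Pn=> x /= /andP[xe xf].
have [y axy Ee] := edgeP eE xe; have [z axz Ef] := edgeP fE xf.
rewrite Ee Ef !dE //; apply: contraNneq nef => /(cP _ _ _ axy axz) E.
by rewrite Ee Ef E.
Qed.

Lemma arc_coloring_sub (T : finType) (r s : rel T) k c :
  subrel s r -> arc_coloring r k c -> arc_coloring s k c.
Proof.
move=> sr [ck cs cP]; split=> [x y /sr|x y /sr|x y z /sr rxy /sr]; auto.
exact: cP.
Qed.

Definition del1 (T : finType) (r : rel T) (x y : T) : rel T :=
  fun a b => r a b && ~~ ((a == x) && (b == y) || (a == y) && (b == x)).

Definition misses (T : finType) (r : rel T) (c : T -> T -> nat) (z : T) (a : nat) :=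
  [forall t, r z t ==> (c z t != a)].

(** * Vizing fans *)

Section Fan.
Variables (T : finType) (r : rel T) (k : nat) (x : T).
Hypotheses (r_sym : symmetric r) (r_irr : irreflexive r).
Hypothesis r_ncol : ~ exists c, arc_coloring r k c.

(** One step of a Vizing fan at [x]: paths for this relation are the fans, and
    uncolouring the last spoke of a fan makes all earlier colours shift by one. *)
Definition fan (r0 : rel T) (c : T -> T -> nat) : rel T :=
  fun z z' => r0 x z' && misses r0 c z (c x z').

Lemma del1_sym y : symmetric (del1 r x y).
Proof.
by move=> a b; rewrite /del1 r_sym orbC [(a == y) && _]andbC [(a == x) && _]andbC.
Qed.

Lemma missesP (s : rel T) c z (a : nat) t : misses s c z a -> s z t -> c z t <> a.
Proof. by move/forallP/(_ t)/implyP => H /H /eqP. Qed.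

(** Shifting the colours along a fan moves the uncoloured spoke to the last
    vertex of the fan; if that vertex and the centre miss a common colour, the
    spoke can be coloured, and the whole graph with it. *)
Lemma fan_shift p y c a :
  arc_coloring (del1 r x y) k c -> r x y -> uniq (y :: p) ->
  path (fan (del1 r x y) c) y p -> a < k ->
  misses (del1 r x y) c (last y p) a -> misses (del1 r x y) c x a -> False.
Proof.
pose recol y b c := fun u v : T =>
  if (u == x) && (v == y) || (u == y) && (v == x) then b else c u v : nat.
have recolP s y0 b (c0 : T -> T -> nat) : symmetric s ->
    (forall u v, s u v ->
       ((u == x) && (v == y0) || (u == y0) && (v == x)) || del1 r x y0 u v) ->
    x != y0 -> b < k -> arc_coloring (del1 r x y0) k c0 ->
    (forall v, v != y0 -> s x v -> c0 x v <> b) ->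
    (forall v, v != x -> s y0 v -> c0 y0 v <> b) ->
    arc_coloring s k (recol y0 b c0).
  move=> s_sym sr nxy bk [ck cs cP] cx cy; split.
  - move=> u v suv; rewrite /recol; case: ifP => // nuv.
    by apply: ck; have := sr _ _ suv; rewrite nuv.
  - move=> u v suv; rewrite /recol [in RHS]orbC ![(v == _) && _]andbC.
    by case: ifP => // nuv; apply: cs; have := sr _ _ suv; rewrite nuv.
  have aux u v w : s u v -> s u w ->
      ((u == x) && (v == y0) || (u == y0) && (v == x)) ->
      recol y0 b c0 u v = recol y0 b c0 u w -> v = w.
    have nyx : (y0 == x) = false by rewrite eq_sym (negPf nxy).
    move=> suv suw E; rewrite /recol E; case: ifP => [|/negbT nw].
      by case/orP: E => /andP[/eqP-> /eqP->];
        rewrite eqxx ?nyx ?(negPf nxy) /= ?orbF => /eqP->.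
    case/orP: E nw suw => /andP[/eqP-> _];
      rewrite eqxx ?nyx ?(negPf nxy) /= ?orbF => nw suw E.
      by case: (cx _ nw suw).
    by case: (cy _ nw suw).
  move=> u v w suv suw.
  have [E|nE] := boolP ((u == x) && (v == y0) || (u == y0) && (v == x)).
    exact: aux.
  have [E'|nE'] := boolP ((u == x) && (w == y0) || (u == y0) && (w == x)).
    by move=> /esym EE; apply/esym; apply: aux EE.
  rewrite /recol (negPf nE) (negPf nE').
  by apply: cP; [have := sr _ _ suv | have := sr _ _ suw];
    rewrite ?(negPf nE) ?(negPf nE').
(* Induction on the fan: give the spoke to [y] the colour of the spoke to the
   next vertex [z1], which becomes the uncoloured one. *)
elim: p y c => [|z1 p IHp] y c cP rxy.
  move=> _ _ ak My Mx; apply: r_ncol; exists (recol y a c).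
  have nxy : x != y by apply: contraTneq rxy => ->; rewrite r_irr.
  apply: recolP => // [u v ruv|v nv rxv|v nv ryv].
  - by rewrite /del1 ruv andTb orbN.
  - apply: missesP Mx _; rewrite /del1 rxv eqxx (negPf nv) /=.
    by rewrite negb_and nxy.
  - apply: missesP My _; rewrite /del1 ryv eqxx (negPf nv) /= orbF.
    by rewrite eq_sym (negPf nxy).
have nxy : x != y by apply: contraTneq rxy => ->; rewrite r_irr.
move=> uq /= /andP[/andP[rz1 My1] pp] ak Ml Mx.
have /andP[ny uq1] := uq; move: ny; rewrite inE negb_or => /andP[nyz1 nyp].
have rxz1 : r x z1 by case/andP: rz1.
have nxz1 : x != z1 by apply: contraTneq rxz1 => ->; rewrite r_irr.
have [ck cs cpr] := cP.
have neq_del z t : z != x -> z != y -> del1 r x y z t = r z t.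
  by move=> /negPf nx /negPf ny; rewrite /del1 nx ny andbT.
have del_neq b z t : del1 r x b z t -> r z t by case/andP.
pose c' := recol y (c x z1) c.
have c'E z t : z != x -> z != y -> c' z t = c z t.
  by move=> /negPf nx /negPf ny; rewrite /c' /recol nx ny.
have c'x t : t != y -> c' x t = c x t.
  by move=> /negPf nt; rewrite /c' /recol nt (negPf nxy) andbF.
have c'M z b : z != x -> z != y -> misses (del1 r x y) c z b ->
    misses (del1 r x z1) c' z b.
  move=> nx ny M; apply/forallP=> t; apply/implyP=> /del_neq rzt.
  by rewrite c'E //; apply/eqP; apply: missesP M _; rewrite neq_del.
have pxy : all (fun z => (z != x) && (z != y)) (z1 :: p).
  rewrite /= eq_sym nxz1 eq_sym nyz1 /=; apply/allP=> z zp.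
  apply/andP; split; last by apply: contraNneq nyp => <-.
  have: r x z.
    elim: (p) (z1) pp zp => //= b q IHq a' /andP[/andP[Hb _] pq].
    by rewrite inE => /orP[/eqP->|/IHq]; [apply: del_neq Hb | apply; exact: pq].
  by apply: contraTneq => ->; rewrite r_irr.
apply: (IHp z1 c') => //.
- apply: recolP => //.
  + exact: del1_sym.
  + by move=> u v /del_neq ruv; rewrite /del1 ruv andTb orbN.
  + exact: ck.
  + move=> v nvy /andP[rxv]; rewrite eqxx (negPf nxz1) /= orbF => nvz1 E.
    case/negP: nvz1; apply/eqP; apply: (cpr x) => //.
    by rewrite /del1 rxv eqxx (negPf nxy) /= orbF.
  + move=> v nvx /del_neq ryv; apply: missesP My1 _.
    by rewrite /del1 ryv (negPf nvx) andbF orbF eq_sym (negPf nxy).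
- have : uniq (z1 :: p) := uq1.
  rewrite cons_uniq => /andP[nz1p _].
  have sub_all : forall a', a' \in z1 :: p -> forall q, path (fan (del1 r x y) c) a' q ->
      {subset q <= p} -> path (fan (del1 r x z1) c') a' q.
    move=> a' a'p q; elim: q a' a'p => //= b q IHq a' a'p /andP[/andP[rb Mb] pq] sq.
    have bp : b \in p by apply: sq; rewrite inE eqxx.
    have /andP[nax nay] := allP pxy _ a'p.
    have /andP[nbx nby] : (b != x) && (b != y).
      by apply: (allP pxy); rewrite inE bp orbT.
    apply/andP; split; last first.
      apply: IHq => //; first by rewrite inE bp orbT.
      by move=> t tq; apply: sq; rewrite inE tq orbT.
    rewrite /fan c'x //; apply/andP; split; last exact: c'M.
    rewrite /del1 (del_neq _ _ _ rb) eqxx (negPf nxz1) /= orbF.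
    by apply: contraNneq nz1p => <-.
  by apply: sub_all => //; rewrite inE eqxx.
- have /andP[nx ny] := allP pxy _ (mem_last z1 p).
  exact: c'M.
- apply/forallP=> t; apply/implyP=> /andP[rxt].
  rewrite eqxx (negPf nxz1) /= orbF => ntz1.
  have [->|nty] := eqVneq t y.
    rewrite /c' /recol !eqxx /=; apply/eqP; exact: missesP Mx rz1.
  rewrite c'x //; apply/eqP; apply: missesP Mx _.
  by rewrite /del1 rxt eqxx (negPf nxy) /= orbF.
Qed.

End Fan.

(** * Kempe chains *)

Section Kempe.
Variables (T : finType) (s : rel T).
Hypothesis s_sym : symmetric s.
Hypothesis s_deg2 : forall a b c d, s a b -> s a c -> s a d ->
  [\/ b = c, b = d | c = d].

Let leaf z := forall a b, s z a -> s z b -> a = b.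

(** In a graph of maximum degree two a walk that never turns back is determined
    by its first edge, and it can only stop at a leaf; so two such walks with the
    same first edge that both end at leaves end at the same one. *)
Lemma two_leaves_path b a p q :
  s a b -> b \notin a :: p -> b \notin a :: q ->
  uniq (a :: p) -> uniq (a :: q) -> path s a p -> path s a q ->
  leaf (last a p) -> leaf (last a q) -> last a p = last a q.
Proof.
elim: p b a q => [|c p IHp] b a [|d q] //= sab.
- move=> _ nb _ _ _ /andP[sad _] la _.
  by move: nb; rewrite (la _ _ sab sad) !inE eqxx orbT.
- move=> nb _ _ _ /andP[sac _] _ _ la.
  by move: nb; rewrite (la _ _ sab sac) !inE eqxx orbT.
move=> nb nb' /andP[na uc] /andP[na' ud] /andP[sac pc] /andP[sad pd] lp lq.
have E : c = d.
  case: (s_deg2 sab sac sad) => // E.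
    by move: nb; rewrite E !inE eqxx orbT.
  by move: nb'; rewrite E !inE eqxx orbT.
by subst d; apply: (IHp a) lp lq => //; rewrite s_sym.
Qed.

(** A component of a graph of maximum degree two has at most two leaves. *)
Lemma connected_leaves x y z : leaf x -> leaf y -> leaf z -> x != y -> x != z ->
  connect s x y -> connect s x z -> y = z.
Proof.
move=> lx ly lz nxy nxz /connectP[p0 pp0 Ey] /connectP[q0 pq0 Ez].
move: ly lz nxy nxz; rewrite {}Ey {}Ez.
case/shortenP: pp0 => p pp up _; case/shortenP: pq0 => q pq uq _.
case: p pp up => [|c p] /=; first by rewrite eqxx.
case: q pq uq => [|d q] /=; first by rewrite eqxx.
move=> /andP[sd pd] /andP[nd ud] /andP[sc pc] /andP[nc uc] lp lq _ _.
have E := lx _ _ sc sd; subst d.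
by apply: (two_leaves_path (b := x)) lp lq => //; rewrite s_sym.
Qed.

End Kempe.

Section KempeSwap.
Variables (T : finType) (r : rel T) (k : nat) (c : T -> T -> nat) (a b : nat).
Hypothesis r_sym : symmetric r.
Hypotheses (cP : arc_coloring r k c) (ak : a < k) (bk : b < k).

Definition two_colored : rel T :=
  fun u v => r u v && ((c u v == a) || (c u v == b)).

Definition kempe_swap z : T -> T -> nat := fun u v =>
  if connect two_colored z u then
    if c u v == a then b else if c u v == b then a else c u v
  else c u v.

Lemma two_colored_sym : symmetric two_colored.
Proof.
case: cP => _ cs _ u v; rewrite /two_colored r_sym.
by have [rv|//] := boolP (r v u); rewrite (cs _ _ rv).
Qed.

Lemma kempe_swap_coloring z : arc_coloring r k (kempe_swap z).
Proof.
have [ck cs cpr] := cP; split=> [u v ruv|u v ruv|u v w ruv ruw].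
- rewrite /kempe_swap; have := ck _ _ ruv.
  by case: ifP => // _; case: ifP => // _; case: ifP.
- rewrite /kempe_swap -(cs _ _ ruv).
  have [E|nE] := boolP (two_colored u v).
    by rewrite (same_connect1r (sym_connect_sym two_colored_sym) E).
  move: nE; rewrite /two_colored ruv negb_or => /andP[/negPf-> /negPf->].
  by rewrite !if_same.
rewrite /kempe_swap => E; apply: (cpr u) => //; move: E.
case: ifP => // _.
by do 4?[case: eqP => ?]; subst; try congruence.
Qed.

Lemma kempe_swap_out z u v : ~~ connect two_colored z u -> kempe_swap z u v = c u v.
Proof. by rewrite /kempe_swap => /negPf->. Qed.

Lemma two_colored_deg2 u v w t : two_colored u v -> two_colored u w ->
  two_colored u t -> [\/ v = w, v = t | w = t].
Proof.
have [_ _ cpr] := cP.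
move=> /andP[rv cv] /andP[rw cw] /andP[rt ct].
have [E|n1] := eqVneq (c u v) (c u w).
  by apply: Or31; apply: cpr E.
have [E|n2] := eqVneq (c u v) (c u t).
  by apply: Or32; apply: cpr E.
apply: Or33; apply: (cpr u) => //.
by case/orP: cv n1 n2 => /eqP->; case/orP: cw => /eqP->;
  case/orP: ct => /eqP->; rewrite ?eqxx.
Qed.

(** A vertex missing one of the two colours is an end of its Kempe chain. *)
Lemma two_colored_leaf z u v : misses r c z a || misses r c z b ->
  two_colored z u -> two_colored z v -> u = v.
Proof.
have [_ _ cpr] := cP.
move=> M /andP[ru cu] /andP[rv cv]; apply: (cpr z) => //.
case/orP: M => M; have /eqP/negPf := missesP M ru; have /eqP/negPf := missesP M rv;
  move=> E1 E2; move: cu cv; rewrite E1 E2 ?orbF ?orFb => /eqP-> /eqP->; done.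
Qed.

End KempeSwap.

(** * Vizing's adjacency lemma *)

Section FanCount.
Variables (T : finType) (r : rel T) (k : nat) (x y : T) (c : T -> T -> nat).
Hypotheses (r_sym : symmetric r) (r_irr : irreflexive r).
Hypothesis r_ncol : ~ exists c, arc_coloring r k c.
Hypotheses (rxy : r x y) (cP : arc_coloring (del1 r x y) k c).

Let r0 := del1 r x y.
Let F := fan x r0 c.

Lemma fan_miss z a : connect F y z -> a < k ->
  misses r0 c z a -> ~~ misses r0 c x a.
Proof.
case/connectP=> p0 pp0 ->; case/shortenP: pp0 => p pp up _ ak M.
apply/negP=> Mx; exact: (fan_shift r_sym r_irr r_ncol cP rxy up pp ak M Mx).
Qed.

(** If the chain of [z] avoided [x], swapping the colours on it would make [z]
    miss the colour [a] missing at [x], against [fan_shift].  The swap may destroy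
    the fan leading to [z], but only behind its first vertex that lies on the
    chain and misses [b]; after the swap that vertex misses [a] and can play the
    part of [z]. *)
Lemma fan_swap a b z : a < k -> b < k -> misses r0 c x a ->
  connect F y z -> misses r0 c z b ->
  connect (two_colored r0 c a b) x z.
Proof.
move=> ak bk Mxa /connectP[p0 pp0 Ez]; move: Ez; case/shortenP: pp0 => p pp up _ Ez Mz.
apply/negPn/negP=> ncon.
set s := two_colored r0 c a b in ncon.
have r0_sym : symmetric r0 by apply: del1_sym.
have s_sym : symmetric s by apply: two_colored_sym cP.
have nzx : ~~ connect s z x by rewrite (sym_connect_sym s_sym).
pose c' := kempe_swap r0 c a b z.
have c'P : arc_coloring r0 k c' by apply: kempe_swap_coloring.
have c'x t : c' x t = c x t by apply: kempe_swap_out.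
have Mx' : misses r0 c' x a.
  by apply/forallP=> t; rewrite c'x; exact: (forallP Mxa t).
suff [q [pq uq Mq]] : exists q, [/\ path (fan x r0 c') y q, uniq (y :: q)
    & misses r0 c' (last y q) a].
  exact: (fan_shift r_sym r_irr r_ncol c'P rxy uq pq ak Mq Mx').
(* [q] is the part of the fan [p] up to the first vertex that misses [b] and lies
   on the chain of [z]. *)
suff [q [pq sq Mq]] : exists q, [/\ path (fan x r0 c') y q, subseq q p
    & misses r0 c' (last y q) a].
  exists q; split=> //; apply: subseq_uniq up.
  by rewrite /= eqxx.
elim: (p) (y) pp Ez => [|z1 q IHq] y0 /= pp Ez.
all: have [/andP[cy0 My0]|ny0] := boolP (connect s z y0 && misses r0 c y0 b).
all: try (exists [::]; split=> //=; apply/forallP=> t; apply/implyP=> rt;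
  rewrite /c' /kempe_swap -/s cy0; have /eqP/negPf nb := missesP My0 rt;
  rewrite nb; case: (boolP (c y0 t == a)) => // Ea; apply/eqP => E;
  by move: nb; rewrite E (eqP Ea) eqxx || by move: nb; rewrite E eqxx).
  by move: ny0; rewrite -Ez connect0 Mz.
have /andP[/andP[rz1 Mz1] pq] := pp.
have [q' [pq' sq' Mq']] := IHq _ pq Ez.
exists (z1 :: q'); split=> //=; last by rewrite eqxx.
rewrite pq' andbT /fan rz1 c'x /=.
have na : c x z1 != a by apply/eqP; exact: missesP Mxa rz1.
apply/forallP=> t; apply/implyP=> rt; have /eqP nt := missesP Mz1 rt.
rewrite /c' /kempe_swap -/s; case: ifP => // cy0.
have nb : c x z1 != b.
  by apply: contraNneq ny0 => <-; rewrite cy0.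
by case: ifP => _; [rewrite eq_sym | case: ifP => // _; rewrite eq_sym].
Qed.

(** Two fan vertices missing [b] would both be ends of the chain that starts at
    [x], which has only one other end. *)
Lemma fan_disjoint a b z z' : a < k -> b < k -> misses r0 c x a ->
  connect F y z -> connect F y z' -> misses r0 c z b -> misses r0 c z' b ->
  z = z'.
Proof.
move=> ak bk Mxa cz cz' Mz Mz'.
have fanx w : connect F y w -> x != w.
  case/connectP=> p pp ->; elim: p y rxy pp => [|w' p IHp] y0 ry0 /=.
    by move=> _; apply: contraTneq ry0 => <-; rewrite r_irr.
  by case/andP=> /andP[/andP[rw _] _]; apply: IHp.
have leaf w : misses r0 c w a || misses r0 c w b -> forall u v,
    two_colored r0 c a b w u -> two_colored r0 c a b w v -> u = v.
  by move=> M u v; apply: (two_colored_leaf cP M).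
have s_sym : symmetric (two_colored r0 c a b).
  by apply: two_colored_sym cP; apply: del1_sym.
have lx := leaf x; rewrite Mxa in lx.
have lz := leaf z; rewrite Mz orbT in lz.
have lz' := leaf z'; rewrite Mz' orbT in lz'.
apply: (connected_leaves s_sym (two_colored_deg2 cP) (lx isT) (lz isT) (lz' isT)).
- exact: fanx.
- exact: fanx.
- exact: fan_swap.
- exact: fan_swap.
Qed.

Lemma card_misses (s : rel T) z : arc_coloring s k c ->
  #|[set a : 'I_k | misses s c z a]| = k - #|[set t | s z t]|.
Proof.
case=> ck cs cpr.
have -> : [set a : 'I_k | misses s c z a] =
    ~: [set a : 'I_k | [exists t, s z t && (c z t == a)]].
  apply/setP=> a; rewrite !inE negb_exists; apply: eq_forallb => t.
  by rewrite negb_and implybE.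
rewrite cardsCs setCK card_ord; congr (_ - _).
case: k ck => [|k'] ck.
  rewrite !eq_card0 // => [t|a]; last by case: a.
  by rewrite !inE; apply/negbTE/negP=> /ck.
have -> : [set a : 'I_k'.+1 | [exists t, s z t && (c z t == a)]] =
    [set inord (c z t) | t in [set t | s z t]].
  apply/setP=> a; rewrite inE; apply/existsP/imsetP => [[t /andP[st /eqP E]]|[t]].
    by exists t; rewrite ?inE // E inord_val.
  rewrite inE => st ->; exists t; rewrite st inordK ?eqxx //; exact: ck.
rewrite card_in_imset // => t t'; rewrite !inE => st st' E.
apply: (cpr z) => //; rewrite -(inordK (ck _ _ st)) -(inordK (ck _ _ st')).
by rewrite E.
Qed.

End FanCount.

Lemma sum_pred (T : finType) (A : {set T}) (P : pred T) :
  \sum_(z in A) (P z : nat) = #|[set z in A | P z]|.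
Proof.
rewrite -sum1_card big_mkcond [RHS]big_mkcond; apply: eq_bigr => z _.
by rewrite inE; case: (z \in A); case: (P z).
Qed.

Section FanSum.
Variables (T : finType) (r : rel T) (k : nat) (x y : T) (c : T -> T -> nat).
Hypotheses (r_sym : symmetric r) (r_irr : irreflexive r).
Hypothesis r_ncol : ~ exists c, arc_coloring r k c.
Hypotheses (rxy : r x y) (cP : arc_coloring (del1 r x y) k c).
Hypothesis dx : #|[set t | r x t]| <= k.

Let r0 := del1 r x y.
Let S := [set z | connect (fan x r0 c) y z].

Lemma del1_neighbors (z : T) : x != y ->
  #|[set t | r x t]| = #|[set t | del1 r x y x t]|.+1.
Proof.
move=> nxy; rewrite (cardsD1 y) inE rxy; congr (_.+1); apply: eq_card => t.
by rewrite !inE /del1 eqxx (negPf nxy) /= orbF andbC.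
Qed.

(** Every colour missing at a fan vertex is used at the centre, on a spoke to
    another fan vertex, and it is missing at one fan vertex only.  So the missing
    colours inject into the fan vertices other than [y]. *)
Lemma fan_deficiency : \sum_(z in S) (k - #|[set t | r0 z t]|) <= #|S :\ y|.
Proof.
have nxy : x != y by apply: contraTneq rxy => ->; rewrite r_irr.
have [a Mxa] : exists a : 'I_k, misses r0 c x a.
  suff /card_gt0P[a] : 0 < #|[set a : 'I_k | misses r0 c x a]|.
    by rewrite inE; exists a.
  by rewrite (card_misses x cP) subn_gt0 -(del1_neighbors x nxy).
(* Double counting of the pairs of a fan vertex and a colour missing there. *)
have -> : \sum_(z in S) (k - #|[set t | r0 z t]|) =
    \sum_(b < k) \sum_(z in S) (misses r0 c z b : nat).
  rewrite exchange_big; apply: eq_bigr => z _.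
  rewrite -(card_misses z cP) -sum1_card big_mkcond; apply: eq_bigr => b _.
  by rewrite inE; case: ifP.
have le1 : \sum_(b < k) \sum_(t in S :\ y) (r0 x t && (c x t == b) : nat) <=
    #|S :\ y|.
  rewrite exchange_big -sum1_card; apply: leq_sum => t _.
  have [rt|] := boolP (r0 x t); last by rewrite big1.
  have [ck _ _] := cP; rewrite (bigD1 (Ordinal (ck _ _ rt))) //= eqxx big1 //.
  by move=> b; rewrite -val_eqE /= eq_sym => /negPf->.
apply: leq_trans le1; apply: leq_sum => b _.
have [[z /= zS Mz]|no] := altP (@exists_inP _ (mem S) (fun z => misses r0 c z b));
  last first.
  rewrite big1 // => z zS; case: (boolP (misses _ _ _ _)) => // Mz.
  by case/exists_inP: no; exists z.
have cz : connect (fan x r0 c) y z by move: (zS : z \in S); rewrite inE.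
rewrite (bigD1 z) //= Mz big1 => [|z' /andP[z'S nz']]; last first.
  case: (boolP (misses _ _ _ _)) => // Mz'; rewrite inE in z'S.
  case/eqP: nz'; exact: (fan_disjoint r_sym r_irr r_ncol rxy cP
    (ltn_ord a) (ltn_ord b) Mxa z'S cz Mz' Mz).
have := fan_miss r_sym r_irr r_ncol rxy cP cz (ltn_ord b) Mz.
case/forallPn=> t; rewrite negb_imply negbK => /andP[rt ct].
have {}rt : r0 x t := rt.
have tS : t \in S :\ y.
  rewrite !inE; apply/andP; split.
    by apply: contraTneq rt => ->; rewrite /r0 /del1 !eqxx andbF.
  by apply: connect_trans cz (connect1 _); rewrite /fan rt (eqP ct).
by rewrite addn0 (bigD1 t) //= rt ct leq_addr.
Qed.

End FanSum.

Lemma adj_del_edge (G : sgraph) (x y : G) :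
  @adj (del_edges [set [set x; y]]) =2 del1 (@adj G) x y.
Proof.
move=> a b /=; rewrite /del_adj /del1 !inE; congr (_ && ~~ _).
apply/eqP/idP => [E|/orP[]/andP[/eqP-> /eqP->] //]; last by rewrite setUC.
have: a \in [set x; y] by rewrite -E set21.
rewrite !inE => /orP[]/eqP Ea; subst a; first by rewrite (set2_inj E) !eqxx.
by move: E; rewrite [[set x; y]]setUC => /set2_inj->; rewrite !eqxx orbT.
Qed.

(** In [fan_deficiency] the vertex [y] contributes k + 1 - deg y, because its edge
    to [x] is uncoloured, and every other fan vertex of degree less than k pays
    for itself; the rest must be paid by fan vertices of degree k. *)
Lemma vizing_adjacency (G : sgraph) (k : nat) (x y : G) :
  (forall z : G, degree z <= k) -> adj x y ->
  ~~ edge_colorable G k -> edge_colorable (del_edges [set [set x; y]]) k ->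
  k < degree y + #|[set z | [&& adj x z, z != y & degree z == k]]|.
Proof.
move=> dk axy nG /edge_colorable_arcP[c cP].
have {}nG : ~ exists c, arc_coloring (@adj G) k c.
  by move=> /edge_colorable_arcP; apply/negP.
have {}cP : arc_coloring (del1 (@adj G) x y) k c.
  by apply: arc_coloring_sub cP => a b; rewrite adj_del_edge.
have := fan_deficiency (@adj_sym G) (@adj_irrefl G) nG axy cP (dk x).
set r0 := del1 _ x y; set S := [set z | connect _ y z].
have nxy : x != y by apply: contraTneq axy => ->; rewrite adj_irrefl.
have yS : y \in S by rewrite inE connect0.
have Sx z : z \in S -> z != y -> adj x z.
  rewrite inE => /connectP[p pp ->]; case: p pp => [|w p]; first by rewrite eqxx.
  elim: p w {1 2}y => [|w' p IHp] w y' /= /andP[/andP[/andP[rw _] _]] // pp _.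
  have [//|] := eqVneq (last w' p) y; last by apply: IHp pp.
  by move->.
have d0 z : z != x -> z != y -> [set t | r0 z t] = [set t | adj z t].
  by move=> /negPf nx /negPf ny; apply/setP=> t; rewrite !inE /r0 /del1 nx ny andbT.
have dy : degree y = #|[set t | r0 y t]|.+1.
  have ayx : adj y x by rewrite adj_sym.
  have nyx : y != x by rewrite eq_sym.
  rewrite /degree (del1_neighbors ayx y nyx).
  by congr (_.+1); apply: eq_card => t; rewrite !inE /r0 /del1 orbC.
rewrite (bigD1 y) //= => le.
have ge : \sum_(z in S :\ y) (degree z != k : nat) <=
   \sum_(z in S | z != y) (k - #|[set t | r0 z t]|).
  rewrite [leqRHS](eq_bigl (mem (S :\ y))) => [|z]; last by rewrite !inE andbC.
  apply: leq_sum => z; rewrite in_setD1 => /andP[nzy zS].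
  have nzx : z != x.
    by apply: contraTneq (Sx _ zS nzy) => ->; rewrite adj_irrefl.
  rewrite d0 //; have := dk z; rewrite leq_eqVlt.
  by case: eqP => //= _; rewrite /degree => H; rewrite subn_gt0.
have E : #|S :\ y| = #|[set z in S :\ y | degree z == k]| +
    \sum_(z in S :\ y) (degree z != k : nat).
  rewrite sum_pred -(cardsID [set z | degree z == k] (S :\ y)).
  by congr (_ + _); apply: eq_card => z; rewrite !inE // andbC.
have sub : #|[set z in S :\ y | degree z == k]| <=
   #|[set z | [&& adj x z, z != y & degree z == k]]|.
  apply: subset_leq_card; apply/subsetP=> z; rewrite !inE.
  case/andP=> /andP[nzy zS] ->; rewrite nzy Sx // inE //.
have dk0 : #|[set t | r0 y t]| < k by rewrite -dy.
lia.
Qed.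

(** * Edge-critical graphs *)

Definition critical (k : nat) (G : sgraph) : Prop :=
  ~~ edge_colorable G k /\
  forall x y : G, adj x y -> edge_colorable (del_edges [set [set x; y]]) k.

Lemma critical_subgraph (G : sgraph) k : ~~ edge_colorable G k ->
  exists F : {set {set G}}, critical k (del_edges F).
Proof.
move=> nG.
have n0 : (set0 \subset edges G) && ~~ edge_colorable (@del_edges G set0) k.
  rewrite sub0set; apply: contra nG => /edge_colorable_arcP[c cP].
  apply/edge_colorable_arcP; exists c; apply: arc_coloring_sub cP => a b ab.
  by rewrite /= /del_adj ab inE.
case: (arg_maxnP (P := fun F : {set {set G}} =>
  (F \subset edges G) && ~~ edge_colorable (del_edges F) k)
  (fun F => #|F|) n0) => F /andP[FE nF] Fmax.
exists F; split=> // x y /andP[axy xyF]; apply: contraT => nxy.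
suff big : ([set x; y] |: F \subset edges G) &&
    ~~ edge_colorable (@del_edges G ([set x; y] |: F)) k.
  by have := Fmax _ big; rewrite /= cardsU1 xyF add1n ltnn.
rewrite subUset FE sub1set (@edge_pair G) axy /=; apply: contra nxy.
move=> /edge_colorable_arcP[c cP]; apply/edge_colorable_arcP; exists c.
apply: arc_coloring_sub cP => a b; rewrite /= /del_adj /= /del_adj !inE.
by case/andP=> /andP[-> nF'] nE; rewrite negb_or nE nF'.
Qed.

Lemma edgeless_colorable (G : sgraph) k :
  (forall x y : G, ~~ adj x y) -> edge_colorable G k.
Proof.
move=> no; apply/edge_colorable_arcP; exists (fun _ _ => 0).
by split=> x y; have /negPf-> := no x y.
Qed.

(** [vizing_adjacency] for the edge [x y] yields a neighbour [z] of degree k, and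
    a second application, to the edge [x z], a neighbour of degree k besides [z]. *)
Lemma critical_neighbor (G : sgraph) k (x y : G) :
  critical k G -> (forall z : G, degree z <= k) -> adj x y ->
  1 < #|[set z | adj x z & degree z == k]|.
Proof.
move=> [nG cG] dk axy.
have [z] : exists z, z \in [set z | [&& adj x z, z != y & degree z == k]].
  apply/card_gt0P; have := vizing_adjacency dk axy nG (cG _ _ axy).
  by have := dk y; lia.
rewrite inE => /and3P[axz _ dz].
have := vizing_adjacency dk axz nG (cG _ _ axz); rewrite (eqP dz).
set B := [set t | _] => lt.
rewrite (cardsD1 z) inE axz dz.
suff : #|B| <= #|[set t | adj x t & degree t == k] :\ z| by lia.
by apply: subset_leq_card; apply/subsetP=> t; rewrite !inE => /and3P[-> -> ->].
Qed.

Lemma degree_del (G : sgraph) (F : {set {set G}}) (x : G) :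
  @degree (del_edges F) x <= degree x.
Proof.
by apply: subset_leq_card; apply/subsetP=> t; rewrite !inE => /andP[].
Qed.

(** A vertex that keeps its degree in a subgraph keeps all its edges. *)
Lemma full_degree_adj (G : sgraph) (F : {set {set G}}) (x y : G) :
  degree x <= @degree (del_edges F) x -> adj x y -> @adj (del_edges F) x y.
Proof.
move=> le axy.
have : [set t | @adj (del_edges F) x t] == [set t | adj x t].
  rewrite eqEcard le andbT; apply/subsetP=> t; rewrite !inE => /andP[] //.
by move/eqP/setP/(_ y); rewrite !inE axy.
Qed.

Lemma critical_core (G : sgraph) k :
  critical k G -> (forall z : G, degree z <= k) ->
  0 < k /\ exists x : G, degree x = k.
Proof.
move=> cG dk; have [nG _] := cG.
have [[x y] /= axy] : exists p : G * G, adj p.1 p.2.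
  apply/existsP; apply: contraR nG => /existsPn no.
  by apply: edgeless_colorable => x y; exact: (no (x, y)).
split.
  by apply: leq_trans (dk x); apply/card_gt0P; exists y; rewrite inE.
have : 0 < #|[set z | adj x z & degree z == k]|.
  by apply: ltnW; apply: critical_neighbor cG dk axy.
by case/card_gt0P=> z; rewrite inE => /andP[_ /eqP]; exists z.
Qed.

Lemma min_degree2_card (G : sgraph) (C : {set G}) (x : G) :
  x \in C -> 1 < #|[set z in C | adj x z]| -> 2 < #|C|.
Proof.
move=> xC lt; rewrite (cardsD1 x) xC add1n ltnS; apply: leq_trans lt _.
apply: subset_leq_card; apply/subsetP=> z; rewrite !inE => /andP[-> axz].
by rewrite andbT; apply: contraTneq axz => ->; rewrite adj_irrefl.
Qed.

(** [C] consists of the vertices of degree k in a critical subgraph.  They retain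
    all their edges there, so each neighbour of [C] belongs to that subgraph and
    [critical_neighbor] applies to it. *)
Lemma noncolorable_core (G : sgraph) k :
  (forall z : G, degree z <= k) -> ~~ edge_colorable G k ->
  exists C : {set G}, [/\ C != set0, forall c, c \in C -> degree c = k
    & forall x, x \in C \/ (exists2 c, c \in C & adj x c) ->
      1 < #|[set z in C | adj x z]|].
Proof.
move=> dk nG; have [F cF] := critical_subgraph nG.
set H := del_edges F in cF.
have dkH (z : H) : degree z <= k by apply: leq_trans (degree_del F z) (dk z).
have [k0 [x0 dx0]] := critical_core cF dkH.
have full (x : G) : @degree H x = k -> degree x = k.
  by move=> dx; apply/eqP; rewrite eqn_leq dk -dx degree_del.
exists [set z | @degree H z == k]; split.
- by apply/set0Pn; exists x0; rewrite inE dx0.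
- by move=> c; rewrite inE => /eqP/full.
move=> x Hx.
have [y axy] : exists y : H, adj (x : H) y.
  case: Hx => [|[c]]; rewrite inE => /eqP dx.
    have : 0 < @degree H x by rewrite dx.
    by case/card_gt0P=> y; rewrite inE; exists y.
  rewrite adj_sym => acx; exists c; rewrite adj_sym.
  by apply: full_degree_adj acx; rewrite dx full.
apply: leq_trans (critical_neighbor cF dkH axy) _.
by apply: subset_leq_card; apply/subsetP=> t; rewrite !inE => /andP[/andP[->]] _ ->.
Qed.

(** With only three vertices available, [C] must be the whole set of vertices of
    degree k of a critical subgraph.  A vertex [x] outside [C] of that subgraph has
    a neighbour c in [C], which sees only two other vertices of [C]; so
    [vizing_adjacency] for the edge c x gives [x] degree at least k - 1 in the
    subgraph.  As its degree in [G] is not k, it keeps all its edges, and the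
    subgraph is a union of components of [G]. *)
Lemma three_core_component (G : sgraph) k (C : {set G}) :
  (forall z : G, degree z <= k) -> ~~ edge_colorable G k ->
  #|C| <= 3 -> (forall x, degree x = k -> x \in C) ->
  #|C| = 3 /\ exists S : {set G}, [/\ C \subset S,
    forall x y, x \in S -> adj x y -> y \in S,
    forall x, x \in S -> k <= (degree x).+1
    & forall x, x \in S -> 1 < #|[set z in C | adj x z]|].
Proof.
move=> dk nG C3 CP; have [F cF] := critical_subgraph nG.
set H := del_edges F in cF.
have dkH (z : H) : degree z <= k by apply: leq_trans (degree_del F z) (dk z).
have [k0 [x0 dx0]] := critical_core cF dkH.
have full (x : G) : @degree H x = k -> degree x = k.
  by move=> dx; apply/eqP; rewrite eqn_leq dk -dx degree_del.
pose CH := [set z | @degree H z == k].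
pose S := [set x : G | [exists y, @adj H x y]].
have CHS : CH \subset S.
  apply/subsetP=> x; rewrite !inE => /eqP dx.
  have : 0 < @degree H x by rewrite dx.
  by case/card_gt0P=> y; rewrite inE => ?; apply/existsP; exists y.
have S2 (x : G) : x \in S -> 1 < #|[set z in CH | @adj H x z]|.
  rewrite inE => /existsP[y axy].
  apply: leq_trans (critical_neighbor cF dkH axy) _.
  by apply: subset_leq_card; apply/subsetP=> t; rewrite !inE andbC.
have sub : CH \subset C by apply/subsetP=> x; rewrite inE => /eqP/full/CP.
have CH3 : 2 < #|CH|.
  have x0H : x0 \in CH by rewrite inE dx0.
  exact: (@min_degree2_card H) (S2 x0 (subsetP CHS _ x0H)).
have EC : CH = C by apply/eqP; rewrite eqEcard sub (leq_trans C3).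
split; first by apply/eqP; rewrite eqn_leq C3 -EC.
have dS (x : G) : x \in S -> degree x <= @degree H x /\ k <= (@degree H x).+1.
  move=> xS.
  have [xC|xC] := boolP (x \in CH).
    move: xC; rewrite inE => /eqP dx; rewrite dx dk; split=> //; exact: leqnSn.
  have : 0 < #|[set z in CH | @adj H x z]| by apply: ltnW; apply: S2.
  case/card_gt0P=> c; rewrite !inE => /andP[dc axc].
  have acx : @adj H c x by rewrite adj_sym.
  have [nH cH] := cF.
  have := vizing_adjacency dkH acx nH (cH _ _ acx).
  set A := [set z | _] => lt.
  have : #|A| <= #|CH :\ c|.
    apply: subset_leq_card; apply/subsetP=> t; rewrite !inE => /and3P[act _ ->].
    by rewrite andbT; apply: contraTneq act => ->; rewrite [adj _ _]adj_irrefl.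
  have cC : c \in CH by rewrite inE.
  have CH3' : #|CH| <= 3 by rewrite EC.
  have := cardsD1 c CH; rewrite cC => E1 E2.
  have lt1 : k <= (@degree H x).+1 by lia.
  split=> //; have : degree x != k.
    by apply: contra xC => /eqP/CP; rewrite EC.
  by have := dk x; lia.
exists S; rewrite -EC; split=> //.
- move=> x y xS axy; have [le _] := dS x xS.
  by rewrite inE; apply/existsP; exists x; rewrite adj_sym; apply: full_degree_adj.
- by move=> x /dS[_ le]; apply: leq_trans le _; rewrite ltnS degree_del.
- move=> x /S2 lt; apply: leq_trans lt _; apply: subset_leq_card.
  by apply/subsetP=> t; rewrite !inE => /andP[-> /andP[->]].
Qed.

(** * Matchings *)

Lemma card_even_involution (T : finType) (A : {set T}) (f : T -> T) :
  (forall x, x \in A -> [/\ f x \in A, f (f x) = x & f x != x]) -> ~~ odd #|A|.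
Proof.
have [n] := ubnP #|A|; elim: n A => // n IHn A; rewrite ltnS => leA fA.
have [->|[x xA]] := set_0Vmem A; first by rewrite cards0.
have [fxA ffx nfx] := fA x xA.
have E : #|A| = #|A :\ x :\ f x|.+2.
  by rewrite (cardsD1 x) xA (cardsD1 (f x) (A :\ x)) !inE nfx fxA.
rewrite E /= negbK; apply: IHn; first by rewrite E in leA; lia.
move=> z; rewrite !inE => /and3P[nz1 nz2 zA]; have [fzA ffz nfz] := fA z zA.
split=> //; rewrite fzA andbT; apply/andP; split.
  by apply: contra nz2 => /eqP E'; rewrite -ffz E' ffx.
by apply: contra nz1 => /eqP E'; rewrite -ffz E'.
Qed.

Section Matching.
Variable G : sgraph.
Implicit Types (f : {ffun G -> G}) (A : {set G}).

(** A matching is encoded as the involution exchanging the ends of its edges; the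
    unmatched vertices are the fixed points. *)
Definition matching f : bool :=
  [forall x, (f (f x) == x) && ((f x != x) ==> adj x (f x))].

Definition supp f : {set G} := [set x | f x != x].

Definition medges f : {set {set G}} := [set [set x; f x] | x in supp f].

Lemma matchingP f : reflect (forall x, f (f x) = x /\ (f x != x -> adj x (f x)))
  (matching f).
Proof.
apply: (iffP forallP) => H x; have := H x.
  by case/andP=> /eqP E /implyP.
by case=> E1 E2; rewrite E1 eqxx; apply/implyP.
Qed.

Lemma supp_even f : matching f -> ~~ odd #|supp f|.
Proof.
move/matchingP=> fP; apply: (@card_even_involution _ _ f) => x; rewrite !inE => nx.
by have [E _] := fP x; rewrite E eq_sym.
Qed.

Lemma mem_medges f (x y : G) : matching f ->
  ([set x; y] \in medges f) = (f x == y) && (x != y).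
Proof.
move/matchingP=> fP; apply/imsetP/andP => [[z] | [/eqP E nxy]].
  rewrite inE => nz E; have [ffz _] := fP z.
  have : x \in [set z; f z] by rewrite -E set21.
  rewrite !inE => /orP[]/eqP Ex; subst x.
    by rewrite (set2_inj E) eq_sym.
  by move: E; rewrite [[set z; _]]setUC => /set2_inj->; rewrite ffz.
by exists x; rewrite ?inE E // eq_sym.
Qed.

Lemma medges_edges f : matching f -> medges f \subset edges G.
Proof.
move/matchingP=> fP; apply/subsetP=> e /imsetP[x]; rewrite inE => nx ->.
by rewrite edge_pair; case: (fP x) => _; apply.
Qed.

Lemma trivIset_medges f : matching f -> trivIset (medges f).
Proof.
move=> fM; have fP := matchingP _ fM.
apply/trivIsetP=> _ _ /imsetP[x xs ->] /imsetP[y ys ->].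
apply: contraR => /pred0Pn[z /=]; rewrite !inE => /andP[/orP zx /orP zy].
have [ffx _] := fP x; have [ffy _] := fP y.
have H w : (z == w) \/ (z == f w) -> f (f w) = w -> [set w; f w] = [set z; f z].
  by case=> /eqP-> // ->; rewrite setUC.
by rewrite (H x) // (H y).
Qed.

Lemma card_medges f : matching f -> 2 * #|medges f| = #|supp f|.
Proof.
move=> fM; have fP := matchingP _ fM.
have -> : supp f = cover (medges f).
  apply/setP=> x; apply/idP/bigcupP => [xs|[e /imsetP[z zs ->]]].
    by exists [set x; f x]; rewrite ?set21 //; apply: imset_f.
  rewrite inE in zs; rewrite !inE => /orP[]/eqP-> //.
  by have [-> _] := fP z; rewrite eq_sym.
rewrite -(eqP (trivIset_medges fM)) mulnC -sum_nat_const; apply: eq_bigr => e.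
by case/imsetP=> x; rewrite inE => nx ->; rewrite cards2 eq_sym nx.
Qed.

Lemma adj_del_matching f (x y : G) : matching f ->
  @adj (del_edges (medges f)) x y = adj x y && (f x != y).
Proof.
move=> fM; rewrite /= /del_adj mem_medges // negb_and negbK.
have [axy|//] := boolP (adj x y).
suff -> : (x == y) = false by rewrite orbF.
by apply/negbTE; apply: contraTneq axy => ->; rewrite adj_irrefl.
Qed.

Lemma degree_del_matching f (x : G) : matching f ->
  degree x = @degree (del_edges (medges f)) x + (x \in supp f).
Proof.
move=> fM; rewrite /degree.
have -> : [set t | @adj (del_edges (medges f)) x t] = [set t | adj x t] :\ f x.
  by apply/setP=> t; rewrite !inE adj_del_matching // andbC eq_sym.
rewrite (cardsD1 (f x)) addnC !inE; congr (_ + _).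
have [_ fx] := matchingP _ fM x; have [E|nE] := eqVneq (f x) x.
  by rewrite E adj_irrefl.
by rewrite fx.
Qed.

Lemma matching_colorable f k : matching f ->
  edge_colorable (del_edges (medges f)) k -> edge_colorable G k.+1.
Proof.
move=> fM /edge_colorable_arcP[c [ck cs cpr]]; apply/edge_colorable_arcP.
have fP := matchingP _ fM.
exists (fun x y => if f x == y then k else c x y); split.
- move=> x y axy; case: ifP => // n; rewrite ltnS ltnW // ck //.
  by rewrite adj_del_matching // axy n.
- move=> x y axy.
  have -> : (f y == x) = (f x == y).
    by apply/eqP/eqP => <-; have [] := fP x; have [] := fP y.
  case: ifP => // n; apply: cs; by rewrite adj_del_matching // axy n.
move=> x y z axy axz; case: ifP => ny; case: ifP => nz.
- by rewrite -(eqP ny) (eqP nz).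
- move=> E; have := ck x z; rewrite -E ltnn adj_del_matching // axz nz.
  by move/(_ isT).
- move=> E; have := ck x y; rewrite E ltnn adj_del_matching // axy ny.
  by move/(_ isT).
by apply: cpr; rewrite adj_del_matching // ?axy ?axz ?ny ?nz.
Qed.

Lemma matching_add f x y : matching f -> f x = x -> f y = y -> adj x y ->
  exists g : {ffun G -> G}, [/\ matching g, supp g = x |: (y |: supp f),
    g x = y & forall z, z != x -> z != y -> g z = f z].
Proof.
move=> /matchingP fP fx fy axy.
have nxy : x != y by apply: contraTneq axy => ->; rewrite adj_irrefl.
have nyx : y != x by rewrite eq_sym.
pose g := [ffun z => if z == x then y else if z == y then x else f z].
have gz z : z != x -> z != y -> g z = f z.
  by move=> /negPf n1 /negPf n2; rewrite ffunE n1 n2.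
have gx : g x = y by rewrite ffunE eqxx.
have gy : g y = x by rewrite ffunE eqxx (negPf nyx).
exists g; split=> //.
  apply/matchingP=> z.
  have [->|nx] := eqVneq z x; first by rewrite gx gy.
  have [->|ny] := eqVneq z y; first by rewrite gy gx adj_sym.
  have [ffz az] := fP z; rewrite gz // gz //.
    by apply: contraNneq nx => E; rewrite -ffz E fx.
  by apply: contraNneq ny => E; rewrite -ffz E fy.
apply/setP=> z; rewrite !inE.
have [->|nx] := eqVneq z x; first by rewrite gx.
have [->|ny] := eqVneq z y; first by rewrite gy.
by rewrite gz.
Qed.

Lemma matching_drop f a : matching f ->
  exists g : {ffun G -> G}, [/\ matching g, supp g = supp f :\ a :\ f a,
    g a = a, g (f a) = f a & forall z, z != a -> z != f a -> g z = f z].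
Proof.
move=> /matchingP fP.
have ffa : f (f a) = a by case: (fP a).
pose g := [ffun z => if (z == a) || (z == f a) then z else f z].
have gz z : z != a -> z != f a -> g z = f z.
  by move=> /negPf n1 /negPf n2; rewrite ffunE n1 n2.
have ga : g a = a by rewrite ffunE eqxx.
have gfa : g (f a) = f a by rewrite ffunE eqxx orbT.
exists g; split=> //.
  apply/matchingP=> z.
  have [->|nx] := eqVneq z a; first by rewrite !ga eqxx.
  have [->|ny] := eqVneq z (f a); first by rewrite !gfa eqxx.
  have [ffz az] := fP z; rewrite gz // gz //.
    by apply: contraNneq ny => <-; rewrite ffz.
  by apply: contraNneq nx => E; rewrite -ffz E ffa.
apply/setP=> z; rewrite !inE.
have [->|nx] := eqVneq z a; first by rewrite ga eqxx andbF.
have [->|ny] := eqVneq z (f a); first by rewrite gfa eqxx.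
by rewrite gz.
Qed.

Definition maximum_matching A f : Prop :=
  [/\ matching f, supp f \subset A &
   forall g, matching g -> supp g \subset A -> #|supp g| <= #|supp f|].

Lemma maximum_matching_exists A : exists f, maximum_matching A f.
Proof.
pose i := [ffun x : G => x].
have iP : matching i && (supp i \subset A).
  apply/andP; split; first by apply/matchingP=> x; rewrite !ffunE eqxx.
  by apply/subsetP=> x; rewrite inE ffunE eqxx.
case: (arg_maxnP (P := fun f => matching f && (supp f \subset A))
  (fun f => #|supp f|) iP) => f /andP[fM fA] fmax.
exists f; split=> // g gM gA; apply: fmax; by rewrite gM.
Qed.

Lemma maximum_matching_free A f x y : maximum_matching A f ->
  x \in A :\: supp f -> y \in A :\: supp f -> ~~ adj x y.
Proof.
move=> [fM fA fmax]; rewrite !inE !negbK => /andP[/eqP fx xA] /andP[/eqP fy yA].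
apply/negP=> axy; have [g [gM gs _ _]] := matching_add fM fx fy axy.
have nxy : x != y by apply: contraTneq axy => ->; rewrite adj_irrefl.
have := fmax g gM; rewrite gs !cardsU1 !inE fx fy !eqxx (negPf nxy) /=.
rewrite !add1n; suff -> : x |: (y |: supp f) \subset A.
  by move/(_ isT); rewrite ltnNge leqnSn.
by apply/subsetP=> z; rewrite !inE => /or3P[/eqP->|/eqP->|?] //;
  apply: (subsetP fA); rewrite inE.
Qed.

(** Two vertices [x], [y] missed by a maximum matching of [A] have all their
    neighbours among the matched vertices.  There is no augmenting path of length
    three, so for no matched [a] are both [x a] and [y (f a)] edges; hence the
    neighbours of [x] and the partners of the neighbours of [y] are disjoint sets
    of matched vertices. *)
Lemma ore_matching A : ~~ odd #|A| ->
  (exists2 f, matching f & supp f = A) \/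
  exists x y, [/\ x \in A, y \in A, x != y &
    #|[set z in A | adj x z]| + #|[set z in A | adj y z]| + 2 <= #|A|].
Proof.
move=> evA; have [f fmaxA] := maximum_matching_exists A.
have [fM fA fmax] := fmaxA; have fP := matchingP _ fM.
have [E|nE] := eqVneq (supp f) A; [by left; exists f | right].
have cA : #|A| = #|supp f| + #|A :\: supp f|.
  by rewrite -(cardsID (supp f) A) (setIidPr fA).
have gt0 : 0 < #|A :\: supp f|.
  rewrite lt0n; apply: contra nE; rewrite cards_eq0 setD_eq0 => AS.
  by rewrite eqEsubset fA.
have evD : ~~ odd #|A :\: supp f|.
  by move: evA; rewrite cA oddD (negPf (supp_even fM)).
have /card_gt1P[x [y [xD yD nxy]]] : 1 < #|A :\: supp f|.
  by case: #|_| gt0 evD => [|[]].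
exists x, y.
have freeN w : w \in A :\: supp f ->
    [set z in A | adj w z] = [set z in supp f | adj w z].
  move=> wD; apply/setP=> z; rewrite !inE; have [awz|] := boolP (adj w z);
    rewrite ?andbF // !andbT.
  apply/idP/idP => [zA|nz]; last by apply: (subsetP fA); rewrite inE.
  apply: contraT => nz; have zD : z \in A :\: supp f by rewrite !inE nz.
  by have := maximum_matching_free fmaxA wD zD; rewrite awz.
have xA : x \in A by case/setDP: xD.
have yA : y \in A by case/setDP: yD.
split=> //.
have fx : f x = x by move: xD; rewrite !inE negbK => /andP[/eqP].
have fy : f y = y by move: yD; rewrite !inE negbK => /andP[/eqP].
rewrite !freeN //.
set B := [set z in supp f | adj x z].
have -> : [set z in supp f | adj y z] = f @: [set z in supp f | adj y (f z)].
  apply/setP=> z; rewrite !inE; apply/andP/imsetP => [[nz ayz]|[w]].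
    have [ffz _] := fP z.
    by exists (f z); rewrite // !inE ffz ayz andbT eq_sym.
  by rewrite !inE => /andP[nw ayw] ->; have [-> _] := fP w; rewrite eq_sym.
rewrite card_imset; last by apply: (can_inj (g := f)) => w; case: (fP w).
set B' := [set z in supp f | adj y (f z)].
have dis : [disjoint B & B'].
  apply/pred0P=> a /=; apply/negP; rewrite !inE.
  case/andP=> /andP[na axa] /andP[_ ayfa].
  have nxa : x != a by apply: contraNneq na => <-; rewrite fx.
  have nya : y != a by apply: contraNneq na => <-; rewrite fy.
  have ffa : f (f a) = a by case: (fP a).
  have nxfa : x != f a by apply: contraNneq nxa => E; rewrite -ffa -E fx.
  have nyfa : y != f a by apply: contraNneq nya => E; rewrite -ffa -E fy.
  (* Augment along the path x, a, f a, y. *)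
  have [g [gM gs ga gfa gE]] := matching_drop a fM.
  have gx : g x = x by rewrite gE.
  have gy : g y = y by rewrite gE.
  have [h [hM hs hx hE]] := matching_add gM gx ga axa.
  have hy : h y = y by rewrite hE // eq_sym.
  have hfa : h (f a) = f a by rewrite hE // eq_sym.
  have [h' [h'M h's _ _]] := matching_add hM hy hfa ayfa.
  have sub : x |: (y |: supp f) \subset supp h'.
    apply/subsetP=> z; rewrite h's hs gs !inE.
    by case: (z == x); case: (z == y); case: (z == a); case: (z == f a).
  have sub' : supp h' \subset A.
    apply/subsetP=> z; rewrite h's hs gs !inE.
    have fsA w : f w != w -> w \in A by move=> nw; apply: (subsetP fA); rewrite inE.
    case/or4P => [/eqP->|/eqP->|/eqP->|] //; first by rewrite fsA // ffa eq_sym.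
    by case/orP=> [/eqP->|/and3P[_ _]]; exact: fsA.
  have := leq_trans (subset_leq_card sub) (fmax _ h'M sub').
  by rewrite !cardsU1 !inE fx fy !eqxx (negPf nxy) /= !add1n ltnNge leqnSn.
have : #|B :|: B'| <= #|supp f|.
  by apply: subset_leq_card; apply/subsetP=> z; rewrite !inE => /orP[]/andP[].
have : 1 < #|A :\: supp f| by apply/card_gt1P; exists x, y.
rewrite cardsU; move: dis; rewrite -setI_eq0 => /eqP->; rewrite cards0; lia.
Qed.

End Matching.

(** * Graphs with exactly three vertices of maximum degree *)

(** Only the linear relations between the cardinals, degrees and sums of the goal
    are used. *)
Ltac card_lia :=
  clear; rewrite ?/degree;
  repeat match goal with
  | |- context [card ?A] => generalize (card A); intro
  | |- context [bigop.body ?i ?r ?F] => generalize (bigop.body i r F); intro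
  end; lia.

Lemma sum_degree_arcs (G : sgraph) :
  \sum_(x : G) degree x = #|[set p : G * G | adj p.1 p.2]|.
Proof.
rewrite -sum1_card (eq_bigl (fun p : G * G => adj p.1 p.2)) => [|p]; last by rewrite inE.
rewrite -(pair_big_dep xpredT (fun x y : G => adj x y) (fun _ _ => 1)) /=.
apply: eq_bigr => x _; rewrite /degree -sum1_card.
by apply: eq_bigl => y; rewrite inE.
Qed.

Lemma sum_degree_even (G : sgraph) : ~~ odd (\sum_(x : G) degree x).
Proof.
rewrite sum_degree_arcs.
apply: (@card_even_involution _ _ (fun p : G * G => (p.2, p.1))) => -[x y].
rewrite !inE /= => axy; split=> //; first by rewrite adj_sym.
by apply: contraTneq axy => -[-> _]; rewrite adj_irrefl.
Qed.

Lemma degree_split (G : sgraph) (A : {set G}) (x : G) :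
  degree x = #|[set z in A | adj x z]| + #|[set z in ~: A | adj x z]|.
Proof.
rewrite /degree -(cardsID A); congr (_ + _); apply: eq_card => z.
  by rewrite !inE andbC.
by rewrite !inE.
Qed.

(** The situation delivered by [three_core_component]: [C] is the set of the three
    vertices of degree k, and all other vertices have degree k - 1. *)
Section ThreeCore.
Variables (G : sgraph) (k : nat) (C : {set G}).
Hypotheses (C3 : #|C| = 3) (dC : forall x, x \in C -> degree x = k)
  (dN : forall x, x \notin C -> (degree x).+1 = k)
  (adjC : forall x, 1 < #|[set z in C | adj x z]|)
  (nG : ~~ edge_colorable G k).

Lemma core_triangle x y : x \in C -> y \in C -> x != y -> adj x y.
Proof.
move=> xC yC nxy; apply: contraT => naxy.
have : #|[set z in C | adj x z]| <= #|C :\ x :\ y|.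
  apply: subset_leq_card; apply/subsetP=> z; rewrite !inE => /andP[-> axz].
  rewrite andbT; apply/andP; split; apply: contraTneq axz => -> //.
  by rewrite adj_irrefl.
have := cardsD1 x C; have := cardsD1 y (C :\ x); have := adjC x.
rewrite C3 xC !inE yC eq_sym nxy /=; card_lia.
Qed.

Lemma core_neighbors_core x : x \in C -> #|[set z in C | adj x z]| = 2.
Proof.
move=> xC; have : #|[set z in C | adj x z]| <= #|C :\ x|.
  apply: subset_leq_card; apply/subsetP=> z; rewrite !inE => /andP[-> axz].
  by rewrite andbT; apply: contraTneq axz => ->; rewrite adj_irrefl.
have := cardsD1 x C; have := adjC x; rewrite C3 xC; card_lia.
Qed.

Lemma two_of_three x y z : y \in C -> z \in C -> y != z -> ~~ adj x z -> adj x y.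
Proof.
move=> yC zC nyz naxz; apply: contraT => naxy.
have : #|[set t in C | adj x t]| <= #|C :\ y :\ z|.
  apply: subset_leq_card; apply/subsetP=> t; rewrite !inE => /andP[-> axt].
  by rewrite andbT; apply/andP; split; apply: contraTneq axt => ->.
have := cardsD1 y C; have := cardsD1 z (C :\ y); have := adjC x.
rewrite C3 yC !inE zC eq_sym nyz /=; card_lia.
Qed.

(** Handshaking: the degree sum 3k + (|G| - 3)(k - 1) is even. *)
Lemma three_core_parity : odd #|G| /\ ~~ odd k.
Proof.
have k0 : 0 < k.
  have /card_gt0P[x xC] : 0 < #|C| by rewrite C3.
  rewrite -(dC xC); apply: leq_trans (ltnW (adjC x)) _.
  by apply: subset_leq_card; apply/subsetP=> z; rewrite !inE => /andP[].
have := sum_degree_even G; rewrite (bigID (mem C)) /=.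
rewrite (eq_bigr (fun _ => k)) => [|x xC]; last exact: dC.
rewrite [X in _ + X](eq_bigr (fun _ => k.-1)) => [|x xC]; last by rewrite -(dN xC).
rewrite [X in _ + X](eq_bigl (mem (~: C))) => [|x]; last by rewrite !inE.
rewrite !sum_nat_const C3; have := cardsC C; rewrite C3 => <-.
by rewrite oddD !oddM oddD /=; case: k k0 => //= k' _; do 2!case: odd.
Qed.

(** Each of the three core vertices has its other two as neighbours, and hence
    k - 2 neighbours outside the core. *)
Lemma core_double_count :
  \sum_(x in ~: C) #|[set z in C | adj x z]| = 3 * (k - 2).
Proof.
rewrite (eq_bigr (fun x => \sum_(z in C) (adj x z : nat))) => [|x _]; last first.
  by rewrite sum_pred.
rewrite exchange_big /= -C3 -sum_nat_const; apply: eq_bigr => z zC.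
rewrite (eq_bigr (fun x => (adj z x : nat))) => [|x _]; last by rewrite adj_sym.
by rewrite sum_pred -(dC zC) (degree_split C z) core_neighbors_core // addKn.
Qed.

(** Deleting such a matching leaves maximum degree k - 1, attained at [u], [v], [w]
    and [y] only.  If k - 1 colours did not suffice, [noncolorable_core] would give
    a set [D] of these vertices; but [w] has lost its edge to [v] and is not
    adjacent to [y], so it has at most the neighbour [u] in [D].  Hence [w] is
    neither in [D] nor adjacent to [D], which excludes [u] as well, and the
    remaining two vertices are too few. *)
Lemma no_near_perfect_matching u v w y f : C = [set u; v; w] ->
  u != v -> u != w -> v != w -> y \notin C -> ~~ adj w y ->
  matching f -> f w = v -> supp f = ~: [set y] -> False.
Proof.
move=> CE nuv nuw nvw yC nawy fM fw fs.
set H := del_edges (medges f).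
have dH (x : G) : degree x = @degree H x + (x != y).
  by rewrite (degree_del_matching x fM) fs !inE.
have k0 : 0 < k by rewrite -(dN yC).
have wy : w != y by apply: contraNneq yC => <-; rewrite CE !inE eqxx !orbT.
have dHk (x : H) : @degree H x <= k.-1.
  have [Ex|nx] := eqVneq (x : G) y; have := dH x; rewrite ?Ex ?nx ?eqxx /=.
    by have := dN yC; card_lia.
  by have [/dC|/dN] := boolP ((x : G) \in C); card_lia.
have nH : ~~ edge_colorable H k.-1.
  by apply: contra nG => /(matching_colorable fM); rewrite prednK.
have [D [D0 dD DP]] := noncolorable_core dHk nH.
have Dsub (x : G) : x \in D -> x \in C \/ x = y.
  move=> /dD dx; have [xC|xC] := boolP (x \in C); first by left.
  right; apply/eqP; apply: contraT => nxy.
  by have := dH x; have := dN xC; rewrite nxy dx; card_lia.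
have fv : f v = w by rewrite -fw; case: (matchingP _ fM w).
have wD1 : #|[set z in D | @adj H w z]| <= #|[set u]|.
  apply: subset_leq_card; apply/subsetP=> z.
  rewrite !inE adj_del_matching // fw => /and3P[/Dsub zD awz nz].
  case: zD => [|E]; last by move: awz; rewrite E (negPf nawy).
  rewrite CE !inE -orbA => /or3P[//|/eqP E|/eqP E].
    by rewrite E eqxx in nz.
  by rewrite E adj_irrefl in awz.
rewrite cards1 in wD1.
have nw (x : G) : x \in D -> x != w /\ ~~ @adj H w x.
  move=> xD; split.
    apply: contraTneq xD => ->; apply/negP=> wD.
    by have := DP w (or_introl wD); rewrite ltnNge wD1.
  apply/negP=> awx.
  have : 1 < #|[set z in D | @adj H w z]| by apply: DP; right; exists x.
  by rewrite ltnNge wD1.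
have Dvy (x : G) : x \in D -> x \in [set v; y].
  move=> xD; have [nxw naw] := nw x xD; rewrite !inE.
  case: (Dsub x xD) => [|->]; last by rewrite eqxx orbT.
  rewrite CE !inE (negPf nxw) orbF => /orP[/eqP E|->//].
  case/negP: naw; rewrite E adj_del_matching // fw eq_sym nuv andbT.
  by apply: core_triangle; rewrite ?CE ?inE ?eqxx ?orbT // eq_sym.
case/set0Pn: D0 => x xD.
have := DP x (or_introl xD); rewrite ltnNge; case/negP.
have : #|[set z in D | @adj H x z]| <= #|[set v; y] :\ x|.
  apply: subset_leq_card; apply/subsetP=> z; rewrite in_setD1 inE.
  move=> /andP[/Dvy -> axz]; rewrite andbT.
  by apply: contraTneq axz => ->; rewrite [adj _ _]adj_irrefl.
move/leq_trans; apply; rewrite -ltnS -add1n.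
have := cardsD1 x [set v; y]; rewrite Dvy // => <-.
by rewrite cards2; case: (v != y).
Qed.

(** A perfect matching of the complement of [v], [w], [y], together with [v w],
    would contradict [no_near_perfect_matching]; [ore_matching] then gives two
    vertices with few neighbours in that complement. *)
Lemma ore_deficit u v w y : C = [set u; v; w] ->
  u != v -> u != w -> v != w -> y \notin C -> ~~ adj w y ->
  exists x x', [/\ x \notin [set v; w; y], x' \notin [set v; w; y], x != x' &
    degree x + degree x' + 5 <= #|G| + #|[set z in [set v; w; y] | adj x z]|
      + #|[set z in [set v; w; y] | adj x' z]|].
Proof.
move=> CE nuv nuw nvw yC nawy.
have nvy : v != y by apply: contraNneq yC => <-; rewrite CE !inE eqxx orbT.
have nwy : w != y by apply: contraNneq yC => <-; rewrite CE !inE eqxx !orbT.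
set B := [set v; w; y].
have B3 : #|B| = 3.
  by rewrite /B setUC cardsU1 cards2 !inE negb_or ![y == _]eq_sym nvy nwy nvw.
have cB : #|G| = 3 + #|~: B| by rewrite -B3 cardsC.
have avw : adj v w by apply: core_triangle; rewrite ?CE ?inE ?eqxx ?orbT.
have [oddG _] := three_core_parity.
have evB : ~~ odd #|~: B| by move: oddG; rewrite cB oddD.
case: (ore_matching evB) => [[f fM fs]|[x [x' [xB x'B nxx' le]]]].
  have out z : z \in B -> f z = z.
    move=> zB; apply/eqP; apply: contraTT zB => nz.
    by rewrite -in_setC -fs inE.
  have fv : f v = v by apply: out; rewrite !inE eqxx.
  have fw : f w = w by apply: out; rewrite !inE eqxx orbT.
  have [g [gM gs gv gE]] := matching_add fM fv fw avw.
  case: (@no_near_perfect_matching u v w y g) => //.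
    by have [E _] := matchingP _ gM v; rewrite -E gv.
  rewrite gs fs; apply/setP=> z; rewrite !inE.
  have [->|] := eqVneq z v; first by rewrite nvy.
  by have [->|] := eqVneq z w; first by rewrite nwy.
exists x, x'; split; rewrite -?in_setC //.
move: le; rewrite (degree_split B x) (degree_split B x') cB; card_lia.
Qed.

(** If the order is not k + 1, some [y] outside the core is not adjacent to a core
    vertex [w].  [core_double_count] gives 2 |G| <= 3 k, and with [ore_deficit] and
    parity this leaves only k = 6 and |G| = 9.  There all estimates are tight:
    each outer vertex has exactly two core neighbours, and the two vertices from
    [ore_deficit] are adjacent to [v], [w], [y].  Exchanging [u] and [v] gives two
    other vertices adjacent to [u], [w], [y], so [y] has six neighbours although
    its degree is 5. *)
Lemma three_core_order : #|G| = k.+1.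
Proof.
have [oddG evk] := three_core_parity.
have /card_gt0P[w wC] : 0 < #|C| by rewrite C3.
apply/eqP; apply: contraT => nN.
have dw : degree w = k by apply: dC.
have sub (x : G) : [set z | adj x z] \subset ~: [set x].
  by apply/subsetP=> z; rewrite !inE; apply: contraTneq => ->; rewrite adj_irrefl.
have cw : #|G| = 1 + #|~: [set w]| by rewrite -(cards1 w) cardsC.
have [y ywC nawy] : exists2 y, y \in ~: [set w] & ~~ adj w y.
  have /properP[_ [y yw]] : [set z | adj w z] \proper ~: [set w].
    rewrite properEcard sub /= ltn_neqAle subset_leq_card // andbT.
    by apply: contra nN; rewrite cw -dw => /eqP <-.
  by rewrite inE => naw; exists y.
have yC : y \notin C.
  apply: contra nawy => yC; apply: core_triangle => //.
  by move: ywC; rewrite !inE eq_sym.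
have nayw : ~~ adj y w by rewrite adj_sym.
have : #|C :\ w| == 2 by apply/eqP; have := cardsD1 w C; rewrite C3 wC; card_lia.
case/cards2P=> u [v [nuv E]].
have CE : C = [set u; v; w] by rewrite -(setD1K wC) E setUC.
have [uC vC] : u \in C /\ v \in C by rewrite CE !inE !eqxx ?orbT.
have nuw : u != w.
  by have : u \in C :\ w; [rewrite E !inE eqxx | rewrite inE => /andP[]; rewrite inE].
have nvw : v != w.
  by have : v \in C :\ w; [rewrite E !inE eqxx orbT | rewrite inE => /andP[]; rewrite inE].
have ayu : adj y u by apply: two_of_three wC nuw nayw.
have ayv : adj y v by apply: two_of_three wC nvw nayw.
have count := core_double_count.
have cC : #|G| = 3 + #|~: C| by rewrite -C3 cardsC.
have ge2 : 2 * #|~: C| <= 3 * (k - 2).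
  by rewrite -count mulnC -sum_nat_const; apply: leq_sum => x _.
have Nk : k.+2 <= #|G|.
  by have := subset_leq_card (sub w); rewrite -/(degree w) dw; move: nN cw; card_lia.
have dge (x : G) : k <= (degree x).+1.
  by have [/dC->|/dN->] := boolP (x \in C).
have k2 : 1 < k.
  by rewrite -dw (degree_split C w) core_neighbors_core.
have card3 (a b c : G) : #|[set a; b; c]| <= 3.
  by rewrite setUC cardsU1 cards2; case: (_ \notin _); case: (_ != _).
have sub3 (a b c z : G) : [set t in [set a; b; c] | adj z t] \subset [set a; b; c].
  by apply/subsetP=> t; rewrite inE => /andP[].
have le3 (a b c z : G) : #|[set t in [set a; b; c] | adj z t]| <= 3.
  exact: leq_trans (subset_leq_card (sub3 _ _ _ _)) (card3 _ _ _).
have all3 (a b c z : G) : 2 < #|[set t in [set a; b; c] | adj z t]| ->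
    [/\ adj z a, adj z b & adj z c].
  move=> gt; have : [set t in [set a; b; c] | adj z t] == [set a; b; c].
    by rewrite eqEcard sub3 (leq_trans (card3 _ _ _)).
  move/eqP/setP=> Ez.
  by split; [have := Ez a | have := Ez b | have := Ez c];
    rewrite !inE eqxx ?orbT.
have [x [x' [xB x'B nxx' le1]]] := ore_deficit CE nuv nuw nvw yC nawy.
have CE' : C = [set v; u; w] by rewrite CE [[set u; v]]setUC.
have nvu : v != u by rewrite eq_sym.
have [z [z' [zB z'B nzz' le2]]] := ore_deficit CE' nvu nvw nuw yC nawy.
have [k6 N9] : k = 6 /\ #|G| = 9.
  have := le3 v w y x; have := le3 v w y x'; have := dge x; have := dge x'.
  move: k2 le1 ge2 cC Nk evk oddG; card_lia.
have only2 t : t \notin C -> [/\ adj t u, adj t v & adj t w] -> False.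
  move=> tC [atu atv atw]; move: count; rewrite (bigD1 t) ?inE //=.
  have -> : [set z in C | adj t z] = C.
    apply/setP=> q; rewrite inE; apply: andb_idr.
    by rewrite CE !inE -orbA => /or3P[]/eqP->.
  have : 2 * #|(~: C) :\ t| <= \sum_(i in ~: C | i != t) #|[set z in C | adj i z]|.
    rewrite mulnC -sum_nat_const (eq_bigl (fun i => (i \in ~: C) && (i != t))).
      by apply: leq_sum => i _.
    by move=> i; rewrite !inE andbC.
  by have := cardsD1 t (~: C); rewrite inE tC; move: C3 k6 N9 cC; card_lia.
have tight a q q' : 
    degree q + degree q' + 5 <= #|G| + #|[set t in [set a; w; y] | adj q t]|
      + #|[set t in [set a; w; y] | adj q' t]| ->
    [/\ q \notin C, q' \notin C, [/\ adj q a, adj q w & adj q y]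
     & [/\ adj q' a, adj q' w & adj q' y]].
  move=> le; have l1 := le3 a w y q; have l2 := le3 a w y q'.
  have d1 := dge q; have d2 := dge q'.
  split; try (by apply: all3; move: le l1 l2 d1 d2 k6 N9; card_lia).
    by apply/negP=> /dC; move: le l1 l2 d1 d2 k6 N9; card_lia.
  by apply/negP=> /dC; move: le l1 l2 d1 d2 k6 N9; card_lia.
have [xC x'C [axv axw axy] [ax'v ax'w ax'y]] := tight _ _ _ le1.
have [zC z'C [azu azw azy] [az'u az'w az'y]] := tight _ _ _ le2.
have nadj a b : a \in C -> b \notin C -> a != b by move=> aC; apply: contraNneq => <-.
have xz a b : a \notin C -> adj a v -> adj a w -> adj b u -> a != b.
  by move=> aC av aw bu; apply/eqP=> Eab; subst b; apply: (only2 a).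
have uq : uniq [:: u; v; x; x'; z; z'].
  rewrite /= !inE !negb_or nuv nxx' nzz' !(nadj u) // !(nadj v) //.
  by rewrite !xz.
have : size [:: u; v; x; x'; z; z'] <= size (enum [set t | adj y t]).
  apply: uniq_leq_size => // t; rewrite mem_enum !inE => /or4P[/eqP->|/eqP->|/eqP->|] //.
    by rewrite adj_sym.
  by case/or3P=> /eqP->; rewrite adj_sym.
rewrite -cardE /= -/(degree y); have := dN yC; move: k6; card_lia.
Qed.

End ThreeCore.

(** * The chromatic edge stability index *)

Lemma chromatic_index_le (G : sgraph) k : edge_colorable G k -> chromatic_index G <= k.
Proof. by rewrite /chromatic_index; case: ex_minnP => m _ mmin /mmin. Qed.

Lemma chromatic_index_colorable (G : sgraph) : edge_colorable G (chromatic_index G).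
Proof. by rewrite /chromatic_index; case: ex_minnP. Qed.

(** The restored edge gets a new colour. *)
Lemma edge_colorable_restore (G : sgraph) (F : {set {set G}}) e k :
  edge_colorable (del_edges F) k -> edge_colorable (@del_edges G (F :\ e)) k.+1.
Proof.
move=> /edge_colorableP[c [ck cP]]; apply/edge_colorableP.
have restored f : f \in edges (@del_edges G (F :\ e)) -> f != e -> f \in edges (del_edges F).
  by rewrite !edges_del !inE negb_and negbK => /andP[/orP[->|->]].
exists (fun f => if f == e then k else c f); split=> [f fE|f g fE gE nfg dis].
  by case: eqP => // /eqP nf; rewrite ltnS ltnW // ck // restored.
case: (eqVneq f e) => [Ef|nf]; case: (eqVneq g e) => [Eg|ng].
- by rewrite Ef Eg eqxx in nfg.
- by rewrite gtn_eqF // ck // restored.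
- by rewrite ltn_eqF // ck // restored.
- by apply: cP; rewrite ?restored.
Qed.

Lemma edge_colorable_del0 (G : sgraph) k :
  edge_colorable (@del_edges G set0) k -> edge_colorable G k.
Proof.
move=> /edge_colorable_arcP[c cP]; apply/edge_colorable_arcP; exists c.
by apply: arc_coloring_sub cP => a b ab; rewrite /= /del_adj ab inE.
Qed.

(** The index is defined by sets whose removal lowers the chromatic index by
    exactly one.  If removing [F] lowers it further, some edge of [F] can be put
    back. *)
Lemma stability_le (G : sgraph) (F : {set {set G}}) k :
  chromatic_index G = k.+1 -> F \subset edges G -> edge_colorable (del_edges F) k ->
  chromatic_edge_stability G <= #|F|.
Proof.
move=> Gk; have [n] := ubnP #|F|; elim: n F => // n IHn F; rewrite ltnS => leF FE colF.
have [E|nE] := eqVneq (chromatic_index (del_edges F)) k.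
  rewrite /chromatic_edge_stability; case: ex_minnP => m _; apply.
  by apply/existsP; exists F; rewrite FE E Gk !eqxx.
have lt : chromatic_index (del_edges F) < k.
  by rewrite ltn_neqAle nE chromatic_index_le.
have [F0|[e eF]] := set_0Vmem F.
  suff /chromatic_index_le : edge_colorable G k by rewrite Gk ltnn.
  by apply: edge_colorable_del0; rewrite -F0.
have cF : #|F| = #|F :\ e|.+1 by rewrite (cardsD1 e) eF.
rewrite cF; apply: leqW; apply: IHn.
- by rewrite -cF.
- by apply: subset_trans FE; apply: subD1set.
have := edge_colorable_restore e (chromatic_index_colorable (del_edges F)).
move/edge_colorableP=> [c [ck cP]]; apply/edge_colorableP; exists c; split=> // f fE.
exact: leq_trans (ck f fE) lt.
Qed.

Lemma stability_attained (G : sgraph) k : chromatic_index G = k.+1 ->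
  exists F : {set {set G}}, [/\ F \subset edges G, edge_colorable (del_edges F) k
    & #|F| = chromatic_edge_stability G].
Proof.
move=> Gk; rewrite /chromatic_edge_stability; case: ex_minnP => m.
case/existsP=> F /and3P[FE /eqP E /eqP cF] _; exists F; split=> //.
by have := chromatic_index_colorable (del_edges F); rewrite E Gk.
Qed.

Lemma degree_le_max (G : sgraph) (x : G) : degree x <= max_degree G.
Proof. exact: (leq_bigmax x). Qed.

Definition core (G : sgraph) : {set G} := [set x | degree x == max_degree G].

Lemma degree_del_matching_full (G : sgraph) (f : {ffun G -> G}) (x : G) :
  matching f ->
  (@degree (del_edges (medges f)) x == max_degree G) = (x \in core G :\: supp f).
Proof.
move=> fM; rewrite in_setD; move: (degree_del_matching x fM) (degree_le_max x).
rewrite [x \in core G]inE; case: (x \in supp f) => /= E; rewrite E ?addn0 //.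
by rewrite addn1 => lt; apply: ltn_eqF.
Qed.

Lemma core_nonempty (G : sgraph) : edges G != set0 -> exists x, x \in core G.
Proof.
case/set0Pn=> e /imsetP[[x0 _] _ _].
have : 0 < #|G| by apply/card_gt0P; exists x0.
by case/(eq_bigmax (@degree G))=> x Ex; exists x; rewrite inE /max_degree Ex.
Qed.

Lemma matching_stability (G : sgraph) (f : {ffun G -> G}) :
  class2 G -> matching f ->
  edge_colorable (del_edges (medges f)) (max_degree G) ->
  2 * chromatic_edge_stability G <= #|supp f|.
Proof.
move=> G2 fM col; rewrite -(card_medges fM) leq_mul2l /=.
exact: stability_le G2 (medges_edges fM) col.
Qed.

(** A form of Fournier's theorem: if no set of vertices that keep maximum degree
    induces a subgraph of minimum degree two, there is no obstruction to colouring
    with max_degree G colours. *)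
Lemma acyclic_core_colorable (G : sgraph) (f : {ffun G -> G}) :
  matching f ->
  (forall C : {set G}, C \subset core G :\: supp f ->
     (forall x, x \in C -> 1 < #|[set z in C | adj x z]|) -> C = set0) ->
  edge_colorable (del_edges (medges f)) (max_degree G).
Proof.
move=> fM acyc; apply: contraT => nH.
have dH (x : del_edges (medges f)) : degree x <= max_degree G.
  exact: leq_trans (degree_del _ _) (degree_le_max _).
have [C [nC dC CP]] := noncolorable_core dH nH; case/negP: nC; apply/eqP/acyc.
  apply/subsetP=> x /dC dx.
  by have := @degree_del_matching_full G f x fM; rewrite dx eqxx => /esym.
move=> x xC; apply: leq_trans (CP x (or_introl xC)) _.
by apply: subset_leq_card; apply/subsetP=> z; rewrite !inE => /andP[-> /andP[]].
Qed.

(** The core vertices missed by a maximum matching of the core are independent. *)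
Lemma maximum_matching_stability (G : sgraph) (f : {ffun G -> G}) :
  class2 G -> maximum_matching (core G) f ->
  2 * chromatic_edge_stability G <= #|supp f|.
Proof.
move=> G2 fmax; have [fM _ _] := fmax; apply: matching_stability => //.
apply: acyclic_core_colorable => // C CU C2; apply/eqP; apply: contraT.
case/set0Pn=> x xC; have /ltnW/card_gt0P[z] := C2 x xC.
rewrite inE => /andP[zC]; apply/contraLR => _.
by apply: maximum_matching_free fmax _ _; apply: (subsetP CU).
Qed.

Lemma stability_bound (G : sgraph) : edges G != set0 -> class2 G ->
  (2 * chromatic_edge_stability G).+1 <= num_max_degree G.
Proof.
move=> E0 G2; have [f fmax] := maximum_matching_exists (core G).
have [fM fA _] := fmax; have le := maximum_matching_stability G2 fmax.
have [Ef|nf] := eqVneq (supp f) (core G); last first.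
  by apply: leq_ltn_trans le (proper_card _); rewrite properEneq nf.
(* The core is perfectly matched: keep the matching edge at [a], so that only its
   two ends have maximum degree after the removal. *)
have [a aK] := core_nonempty E0.
have [g [gM gs _ _ _]] := matching_drop a fM.
have nfa : f a != a by move: aK; rewrite -Ef inE.
have cK : num_max_degree G = #|supp g|.+2.
  rewrite /num_max_degree -/(core G) -Ef gs (cardsD1 a) inE nfa.
  have [ffa _] := matchingP _ fM a.
  by rewrite (cardsD1 (f a) (_ :\ a)) !inE nfa ffa eq_sym nfa.
suff : 2 * chromatic_edge_stability G <= #|supp g| by rewrite cK !ltnS; exact: leqW.
apply: matching_stability => //; apply: acyclic_core_colorable => // C CU C2.
have [//|[x xC]] := set_0Vmem C; have := min_degree2_card xC (C2 x xC).
rewrite ltnNge; case/negP.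
have : C \subset [set a; f a].
  apply: subset_trans CU _; apply/subsetP=> z; rewrite gs -Ef !inE.
  by case: (z == a); case: (z == f a); rewrite ?orbT //= andNb.
by move/subset_leq_card/leq_trans; apply; rewrite cards2; case: (_ != _).
Qed.

(** [w] is the only core vertex missed by the maximum matching [f].  For each
    matched [a], dropping the edge at [a] from [f] leaves too few edges to make the
    rest colourable, so [three_core_component] applies to [a], its partner and [w];
    in particular [w] is adjacent to every core vertex.  Therefore the component
    found there contains the core, hence both ends of every removed edge, and it is
    closed under adjacency in [G]. *)
Lemma stability_extremal (G : sgraph) : class2 G -> connected_graph G ->
  (2 * chromatic_edge_stability G).+1 = num_max_degree G ->
  [/\ #|G| = (max_degree G).+1, odd #|G|, 2 < num_max_degree G &
    forall x : G, max_degree G <= (degree x).+1].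
Proof.
move=> G2 conG tE.
have es0 : 0 < chromatic_edge_stability G.
  rewrite lt0n; apply/eqP=> es0; have [F [_ col]] := stability_attained G2.
  rewrite es0 => /eqP; rewrite cards_eq0 => /eqP F0.
  suff /chromatic_index_le : edge_colorable G (max_degree G) by rewrite G2 ltnn.
  by apply: edge_colorable_del0; rewrite -F0.
have [f fmax] := maximum_matching_exists (core G).
have [fM fA _] := fmax; have fP := matchingP _ fM.
have le := maximum_matching_stability G2 fmax.
have cK : num_max_degree G = #|supp f| + #|core G :\: supp f|.
  by rewrite /num_max_degree -/(core G) -(cardsID (supp f)) (setIidPr fA).
have U1 : #|core G :\: supp f| == 1.
  by have := supp_even fM; move: tE le; rewrite cK; card_lia.
have cs : #|supp f| = 2 * chromatic_edge_stability G.
  by move: tE; rewrite cK (eqP U1); card_lia.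
case/cards1P: U1 => w UE.
have wU : w \in core G :\: supp f by rewrite UE set11.
have [wK fw] : w \in core G /\ f w = w.
  by move: wU; rewrite !inE negbK => /andP[/eqP-> ->].
have dropP a : a \in supp f -> exists (g : {ffun G -> G}) (C : {set G}),
   [/\ matching g, g w = w, supp g \subset core G, C = core G :\: supp g
    & [/\ #|C| <= 3, w \in C, a \in C
    & ~~ edge_colorable (del_edges (medges g)) (max_degree G)]].
  move=> aS; have [g [gM gs ga gfa gE]] := matching_drop a fM.
  have nfa : f a != a by rewrite inE in aS.
  have [ffa _] := fP a.
  have nwa : w != a by apply: contraNneq nfa => <-; rewrite fw.
  have nwfa : w != f a by apply: contraNneq nwa => E; rewrite -ffa -E fw.
  have gw : g w = w by rewrite gE.
  have aK := subsetP fA _ aS.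
  exists g, (core G :\: supp g); split=> //.
    rewrite gs; apply: subset_trans fA; apply/subsetP=> z.
    by rewrite !inE => /and3P[_ _].
  split.
  - apply: leq_trans (_ : #|[set w] :|: [set a; f a]| <= _).
      apply: subset_leq_card; rewrite -UE; apply/subsetP=> z.
      rewrite gs !inE; case: (z == a); rewrite ?orbT //.
      by case: (z == f a); rewrite ?orbT //= orbF.
    by rewrite cardsU1 cards2; case: (_ \notin _); case: (_ != _).
  - by rewrite in_setD wK inE gw eqxx.
  - by rewrite in_setD aK inE ga eqxx.
  apply/negP=> /(matching_stability G2 gM); rewrite -cs gs.
  rewrite (cardsD1 a (supp f)) aS (cardsD1 (f a) (_ :\ a)) !inE nfa ffa eq_sym nfa.
  by rewrite !add1n ltnNge leqnSn.
have comp (g : {ffun G -> G}) (C : {set G}) : matching g -> C = core G :\: supp g ->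
    #|C| <= 3 -> ~~ edge_colorable (del_edges (medges g)) (max_degree G) ->
    #|C| = 3 /\ exists S : {set G}, [/\ C \subset S,
    forall x y : G, x \in S -> @adj (del_edges (medges g)) x y -> y \in S,
    forall x : G, x \in S -> max_degree G <= (@degree (del_edges (medges g)) x).+1
    & forall x : G, x \in S -> 1 < #|[set z in C | @adj (del_edges (medges g)) x z]|].
  move=> gM CE C3 nH; apply: (three_core_component (G := del_edges (medges g))) => //.
    by move=> x; exact: leq_trans (degree_del _ _) (degree_le_max _).
  by move=> x dx; have := @degree_del_matching_full G g x gM; rewrite dx eqxx CE => /esym.
have adjw a : a \in supp f -> adj w a.
  move=> aS; have [g [C [gM gw gK CE [C3 wC aC nH]]]] := dropP a aS.
  have [C3' [S [CS _ _ S2]]] := comp g C gM CE C3 nH.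
  have nwa : w != a by apply: contraTneq aS => <-; rewrite inE fw eqxx.
  apply: contraT => naw; have := S2 w (subsetP CS _ wC).
  rewrite ltnNge; case/negP.
  apply: leq_trans (_ : #|C :\ w :\ a| <= 1).
    apply: subset_leq_card; apply/subsetP=> z; rewrite !inE => /andP[-> /andP[awz _]].
    rewrite andbT; apply/andP; split; apply: contraTneq awz => -> //.
    by rewrite adj_irrefl.
  have := cardsD1 w C; have := cardsD1 a (C :\ w); rewrite wC !inE aC eq_sym nwa /=.
  by move: C3'; card_lia.
have [a aS] : exists a, a \in supp f.
  by apply/card_gt0P; rewrite cs muln_gt0.
have [g [C [gM gw gK CE [C3 wC aC nH]]]] := dropP a aS.
have [C3' [S [CS Scl Sd S2]]] := comp g C gM CE C3 nH.
have KS x : x \in core G -> x \in S.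
  move=> xK; have [fx|nfx] := eqVneq (f x) x.
    have : x \in core G :\: supp f by rewrite in_setD xK inE fx eqxx.
    by rewrite UE inE => /eqP->; apply: (subsetP CS).
  apply: (Scl w); first exact: (subsetP CS).
  have xS : x \in supp f by rewrite inE.
  rewrite adj_del_matching // adjw // gw /=.
  by apply: contraTneq xS => <-; rewrite inE fw eqxx.
have Sadj (x y : G) : x \in S -> adj x y -> y \in S.
  move=> xS axy; have [E|nE] := eqVneq (g x) y; last first.
    by apply: Scl xS _; rewrite adj_del_matching // axy.
  apply: KS; apply: (subsetP gK); rewrite inE -E.
  have [-> _] := matchingP _ gM x; rewrite E.
  by apply: contraTneq axy => ->; rewrite adj_irrefl.
have ST x : x \in S.
  have /connectP[p pp ->] := conG w x; have wS := subsetP CS _ wC.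
  elim: p (w) wS pp => //= b p IHp b' b'S /andP[ab /IHp].
  by apply; apply: Sadj ab.
have dC (x : del_edges (medges g)) : x \in C -> degree x = max_degree G.
  by move=> xC; apply/eqP; rewrite (@degree_del_matching_full G g x gM) -CE.
have dN (x : del_edges (medges g)) : x \notin C -> (degree x).+1 = max_degree G.
  move=> xC; apply/eqP; rewrite eqn_leq (Sd x (ST x)) andbT ltn_neqAle.
  rewrite (@degree_del_matching_full G g x gM) -CE xC.
  exact: leq_trans (degree_del _ _) (degree_le_max _).
have S2' (x : del_edges (medges g)) := S2 x (ST x).
split.
- exact: (@three_core_order (del_edges (medges g)) _ C C3' dC dN S2' nH).
- by have [] := @three_core_parity (del_edges (medges g)) _ C C3' dC dN S2'.
- by rewrite -tE ltnS mul2n -addnn (leq_add es0 es0).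
- by move=> x; apply: leq_trans (Sd x (ST x)) _; rewrite ltnS degree_del.
Qed.

(** * Complete graphs minus a matching *)

(** Every vertex has at most one non-neighbour, so non-adjacency is a matching of
    the complete graph; the vertices of degree 2 n are those it misses, and there
    are at least three of them. *)
Lemma near_complete_minus_matching (G : sgraph) n : #|G| = 2 * n + 1 ->
  (forall x : G, 2 * n <= (degree x).+1) ->
  2 < #|[set x : G | degree x == 2 * n]| ->
  exists s, s < n /\ complete_minus_matching n s G.
Proof.
move=> GE dG; set Full := [set x : G | degree x == _] => t2.
pose K := complete_graph (2 * n + 1).
pose psi (i : K) : G := enum_val (cast_ord (esym GE) i).
pose phi (x : G) : K := cast_ord GE (enum_rank x).
have phiK : cancel phi psi by move=> x; rewrite /psi cast_ordK enum_rankK.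
have psiK : cancel psi phi by move=> i; rewrite /phi enum_valK cast_ordKV.
pose nonadj (i j : K) := (i != j) && ~~ adj (psi i) (psi j).
have cnon (x : G) : #|[set y | (x != y) && ~~ adj x y]| + degree x = 2 * n.
  have := cardsC [set z | adj x z]; have := cardsD1 x (~: [set z | adj x z]).
  rewrite GE inE inE adj_irrefl /= -/(degree x).
  have -> : ~: [set z | adj x z] :\ x = [set y | (x != y) && ~~ adj x y].
    by apply/setP=> y; rewrite !inE eq_sym.
  card_lia.
have uniq_non i j j' : nonadj i j -> nonadj i j' -> j = j'.
  move=> /andP[n1 a1] /andP[n2 a2]; apply: (can_inj psiK).
  have /card_le1P le1 : #|[set y | (psi i != y) && ~~ adj (psi i) y]| <= 1.
    by move: (cnon (psi i)) (dG (psi i)); card_lia.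
  have mem l : i != l -> ~~ adj (psi i) (psi l) ->
      psi l \in [set y | (psi i != y) && ~~ adj (psi i) y].
    by move=> nil ail; rewrite inE (inj_eq (can_inj psiK)) nil.
  by have := le1 _ (mem j n1 a1) (psi j'); rewrite mem // inE => /esym/eqP.
have non_sym i j : nonadj i j = nonadj j i by rewrite /nonadj eq_sym adj_sym.
pose f : {ffun K -> K} := [ffun i => odflt i [pick j | nonadj i j]].
have fE i j : nonadj i j -> f i = j.
  move=> nij; rewrite ffunE; case: pickP => [j' nij'|/(_ j)] /=; last by rewrite nij.
  exact: uniq_non nij' nij.
have fN i : f i != i -> nonadj i (f i).
  by rewrite ffunE; case: pickP => //=; rewrite eqxx.
have fM : matching f.
  apply/matchingP=> i; have [E|/fN nif] := eqVneq (f i) i; first by rewrite !E; split.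
  split; first by apply: fE; rewrite non_sym.
  by move=> _; have /andP[] := nif.
have adjE i j : @adj (del_edges (medges f)) i j = adj (psi i) (psi j).
  rewrite adj_del_matching //= /complete_adj.
  have [<-|nij] := eqVneq i j; first by rewrite adj_irrefl.
  have [aij|naij] := boolP (adj (psi i) (psi j)).
    apply/eqP=> E; have /andP[] : nonadj i j by rewrite -E; apply: fN; rewrite E eq_sym.
    by rewrite aij.
  by apply/negbTE; rewrite negbK; apply/eqP/fE; rewrite /nonadj nij.
exists #|medges f|; split; last first.
  exists (medges f); split=> //.
  - exact: medges_edges.
  - exact: trivIset_medges.
  exists phi; split; first by exists psi.
  by move=> x y; rewrite adjE !phiK.
have : #|supp f| + #|Full| <= 2 * n + 1.
  have -> : 2 * n + 1 = #|supp f| + #|~: supp f| by rewrite cardsC card_ord.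
  rewrite leq_add2l -(card_imset _ (can_inj phiK)).
  apply: subset_leq_card; apply/subsetP=> i /imsetP[x]; rewrite inE => /eqP dx {i}->.
  rewrite !inE negbK; apply: contraT => /fN; rewrite /nonadj phiK => /andP[n1 n2].
  have : psi (f (phi x)) \in [set y | (x != y) && ~~ adj x y].
    by rewrite inE n2 andbT -[x in x != _]phiK (inj_eq (can_inj psiK)).
  have -> : [set y | (x != y) && ~~ adj x y] = set0.
    by apply/eqP; rewrite -cards_eq0; move: (cnon x); rewrite dx; card_lia.
  by rewrite inE.
by rewrite -card_medges //; move: t2; card_lia.
Qed.

Lemma degree_del_edges (G : sgraph) (F : {set {set G}}) (x : G) :
  F \subset edges G ->
  degree x = @degree (del_edges F) x + #|[set e in F | x \in e]|.
Proof.
move=> FE.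
rewrite [LHS](degree_split [set y | [set x; y] \in F] x) addnC; congr (_ + _).
  by apply: eq_card => y; rewrite !inE andbC.
have -> : [set e in F | x \in e] =
    [set [set x; y] | y in [set z in [set y | [set x; y] \in F] | adj x z]].
  apply/setP=> e; rewrite inE; apply/andP/imsetP => [[eF xe]|[y]].
    have [y axy E] := edgeP (subsetP FE _ eF) xe.
    by exists y; rewrite // !inE -E eF.
  by rewrite !inE => /andP[xyF _] ->; rewrite set21.
by rewrite card_imset // => y z; apply: set2_inj.
Qed.

Lemma card_edge (G : sgraph) (e : {set G}) : e \in edges G -> #|e| = 2.
Proof.
case/imsetP=> -[x y]; rewrite inE /= => axy ->; rewrite cards2.
by case: eqP axy => // ->; rewrite adj_irrefl.
Qed.

Lemma sum_degree_del (G : sgraph) (F : {set {set G}}) : F \subset edges G ->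
  \sum_(x : G) degree x = \sum_(x : G) @degree (del_edges F) x + 2 * #|F|.
Proof.
move=> FE; rewrite (eq_bigr _ (fun x _ => degree_del_edges x FE)) big_split /=.
congr (_ + _); rewrite (eq_bigr (fun x => \sum_(e in F) (x \in e : nat))).
  rewrite exchange_big mulnC -sum_nat_const; apply: eq_bigr => e eF.
  rewrite -(card_edge (subsetP FE _ eF)) -sum1_card [RHS]big_mkcond.
  by apply: eq_bigr => x _; case: (x \in e).
by move=> x _; rewrite sum_pred.
Qed.

(** The vertices that see a given colour are paired by its edges, so on an odd
    number of vertices every colour is missing somewhere. *)
Lemma odd_order_sum_degree (G : sgraph) k :
  odd #|G| -> (forall x : G, degree x <= k) -> edge_colorable G k ->
  \sum_(x : G) degree x + k <= k * #|G|.
Proof.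
move=> oddG dk /edge_colorable_arcP[c cP]; have [ck cs cpr] := cP.
have seen_even (a : nat) : ~~ odd #|[set x | ~~ misses (@adj G) c x a]|.
  pose mate x := odflt x [pick y | adj x y && (c x y == a)].
  have mateP x : ~~ misses (@adj G) c x a -> adj x (mate x) /\ c x (mate x) = a.
    rewrite /mate; case: pickP => [y /andP[axy /eqP]//|no].
    by case/forallPn=> y; rewrite negb_imply negbK no.
  apply: (@card_even_involution _ _ mate) => x; rewrite inE => /mateP[axm cxm].
  have am : adj (mate x) x by rewrite adj_sym.
  have cm : c (mate x) x = a by rewrite -cs.
  have Mm : ~~ misses (@adj G) c (mate x) a.
    by apply/forallPn; exists x; rewrite am cm eqxx.
  split; first by rewrite inE.
    have [amm cmm] := mateP _ Mm.
    by apply: (cpr (mate x)); rewrite // cmm cm.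
  by apply: contraTneq axm => ->; rewrite adj_irrefl.
have : k <= \sum_(x : G) (k - degree x).
  rewrite (eq_bigr (fun x => \sum_(a < k) (misses (@adj G) c x a : nat))).
    rewrite exchange_big -[leqLHS]card_ord -sum1_card; apply: leq_sum => a _.
    have : odd #|[set x | misses (@adj G) c x a]|.
      move: oddG (seen_even a); rewrite -(cardsC [set x | misses (@adj G) c x a]) oddD.
      have -> : ~: [set x | misses (@adj G) c x a] = [set x | ~~ misses (@adj G) c x a].
        by apply/setP=> x; rewrite !inE.
      by case: odd; case: odd.
    move/odd_gt0/leq_trans; apply; rewrite -sum1_card [leqLHS]big_mkcond.
    by apply: leq_sum => x _; rewrite inE; case: misses.
  move=> x _; rewrite /degree -(card_misses x cP) -sum1_card big_mkcond.
  by apply: eq_bigr => a _; rewrite inE; case: misses.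
have : \sum_(x : G) (k - degree x) + \sum_(x : G) degree x = k * #|G|.
  rewrite -big_split /= (eq_bigr (fun _ => k)) => [|x _]; last exact: subnK.
  by rewrite sum_nat_const mulnC.
by move=> <-; rewrite addnC leq_add2r.
Qed.

Lemma near_complete_stability (G : sgraph) n s : class2 G -> s < n ->
  complete_minus_matching n s G ->
  num_max_degree G <= (2 * chromatic_edge_stability G).+1.
Proof.
move=> G2 sn [F [FE FT Fs [phi [[psi phiK psiK] phiE]]]].
set K := complete_graph _ in F FE FT Fs phi psi phiK psiK phiE.
set H := del_edges F in phi psi phiK psiK phiE.
have cK : #|K| = (2 * n).+1 by rewrite card_ord addn1.
have GK : #|G| = (2 * n).+1.
  by rewrite -cK; apply: (bij_eq_card (f := phi)); exists psi.
have dphi (x : G) : @degree H (phi x) = degree x.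
  rewrite /degree -(card_imset _ (can_inj phiK)); apply: eq_card => i.
  rewrite inE; apply/idP/imsetP => [ai|[y]].
    by exists (psi i); rewrite ?psiK // inE -phiE psiK.
  by rewrite inE -phiE => axy ->.
have dK (i : K) : degree i = 2 * n.
  have := cardsD1 i [set: K]; rewrite cardsT cK inE /= => -[->].
  by apply: eq_card => j; rewrite !inE andbT eq_sym.
have cover_count (i : K) : #|[set e in F | i \in e]| = (i \in cover F).
  have [/bigcupP[e eF ie]|ni] := boolP (i \in cover F).
    apply/eqP/cards1P; exists e; apply/setP=> e'; rewrite !inE.
    apply/andP/eqP => [[e'F ie']|->//].
    apply/eqP; apply: contraT => nee; have /trivIsetP/(_ _ _ e'F eF nee) := FT.
    by move/pred0P/(_ i); rewrite /= ie ie'.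
  apply/eqP; rewrite cards_eq0; apply/eqP/setP=> e; rewrite !inE.
  by apply/negbTE; apply: contra ni => /andP[eF ie]; apply/bigcupP; exists e.
have dH (i : K) : 2 * n = @degree H i + (i \in cover F).
  by rewrite -(dK i) (degree_del_edges i FE) cover_count.
have cc : #|cover F| = 2 * s.
  rewrite -(eqP FT) -Fs mulnC -sum_nat_const; apply: eq_bigr => e eF.
  exact: card_edge (subsetP FE _ eF).
have dG (x : G) : 2 * n = degree x + (phi x \in cover F) by rewrite -dphi -dH.
have cU : #|~: cover F| = (2 * (n - s)).+1.
  by have := cardsC (cover F); rewrite cc cK; move: sn; card_lia.
have max2n : max_degree G = 2 * n.
  apply/eqP; rewrite eqn_leq; apply/andP; split.
    by apply/bigmax_leqP=> x _; rewrite (dG x) leq_addr.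
  have /card_gt0P[i] : 0 < #|~: cover F| by rewrite cU.
  rewrite inE => ni; apply: leq_trans (degree_le_max (psi i)).
  by rewrite (dG (psi i)) psiK (negPf ni) addn0.
have tE : num_max_degree G = (2 * (n - s)).+1.
  rewrite -cU /num_max_degree max2n -(card_imset _ (can_inj phiK)).
  apply: eq_card => i; rewrite inE; apply/imsetP/idP => [[x]|ni].
    rewrite inE => /eqP dx ->; have := dG x; rewrite dx.
    by case: (_ \in _) => //; rewrite addn1 => /n_Sn.
  exists (psi i); rewrite ?psiK // inE (dG (psi i)) psiK (negPf ni) addn0 //.
have sumG : \sum_(x : G) degree x + 2 * s = 2 * n * (2 * n).+1.
  have <- : \sum_(x : G) (2 * n) = 2 * n * (2 * n).+1.
    by rewrite sum_nat_const GK mulnC.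
  rewrite (eq_bigr _ (fun x _ => dG x)) big_split /=; congr (_ + _).
  rewrite -cc -sum1_card big_mkcond /= (reindex phi) /=; last by exists psi => x _.
  by apply: eq_bigr => x _; case: (_ \in _).
have [F' [F'E col cF']] := stability_attained G2.
rewrite max2n in col.
have dk (x : del_edges F') : degree x <= 2 * n.
  by apply: leq_trans (degree_del F' x) _; rewrite (dG x) leq_addr.
have oddG : odd #|G| by rewrite GK /= mul2n odd_double.
have := odd_order_sum_degree (G := del_edges F') oddG dk col.
rewrite GK -sumG (sum_degree_del F'E) -addnA leq_add2l cF' tE ltnS.
by move: sn; clear; lia.
Qed.

(** * The bound over the rationals *)

Import GRing.Theory Num.Theory.
Local Open Scope ring_scope.

Lemma half_pred_le (m t : nat) :
  (m%:R <= (t%:R - 1) / 2 :> rat) = (2 * m < t)%N.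
Proof.
rewrite ler_pdivlMr // lerBrDr -natrM -[1]/(1%:R) -natrD ler_nat mulnC addn1.
by [].
Qed.

Lemma half_pred_eq (m t : nat) :
  (m%:R = (t%:R - 1) / 2 :> rat) <-> (2 * m).+1 = t.
Proof.
split=> [E|<-].
  have: m%:R * 2 + 1 = t%:R :> rat by rewrite E divfK // subrK.
  by rewrite -natrM -[1]/(1%:R) -natrD => /eqP; rewrite eqr_nat => /eqP; rewrite mulnC addn1.
by rewrite -addn1 natrD addrK natrM mulrC mulKf.
Qed.

Theorem theorem4 (G : sgraph) (hE : edges G != set0) (hG : class2 G) :
  (chromatic_edge_stability G)%:R <= ((num_max_degree G)%:R - 1) / 2 :> rat
  /\
  (connected_graph G -> odd (num_max_degree G) ->
    ((chromatic_edge_stability G)%:R = ((num_max_degree G)%:R - 1) / 2 :> rat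
     <->
     exists n s : nat, (s < n)%N /\ complete_minus_matching n s G)).
Proof.
have bound := stability_bound hE hG.
split=> [|conG _]; first by rewrite half_pred_le.
rewrite half_pred_eq; split=> [tE|[n [s [sn cG]]]]; last first.
  by apply/eqP; rewrite eqn_leq bound (near_complete_stability hG sn cG).
have [GE oddG t2 dG] := stability_extremal hG conG tE.
have Gn : max_degree G = (2 * #|G|./2)%N.
  by have := odd_double_half #|G|; rewrite oddG mul2n GE => -[].
exists #|G|./2; apply: near_complete_minus_matching.
- by rewrite -Gn GE addn1.
- by move=> x; rewrite -Gn.
- by rewrite -Gn.
Qed.
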